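(* Let $F\colon\mathcal{W}\to\mathbb{R}^{m\times n}$ be smooth and let $W\colon[t_0,t_1]\to\mathcal{W}$, with $0\in[t_0,t_1]$, be an integral curve of the assignment flow $\dot W(t) = \mathcal{R}_{W(t)}[F(W(t))]$. If $W$ is a critical point of the action functional $$\mathcal{L}(W) = \int_{t_0}^{t_1} \tfrac{1}{2}\|\dot{W}(t)\|_g^2 + \tfrac{1}{2}\sum_{i=1}^m \mathrm{Var}_{W_i(t)}\big(F_i(W(t))\big)\, dt$$ with initial value $W(0)\in\mathcal{Q}$, then, up to reparametrization, $W(t)$ is a geodesic of the Jacobi metric $h_0$ on $\mathcal{Q}$ given by $$(h_0)_W = \tfrac12\sum_{k=1}^m\mathrm{Var}_{W_k}\big(F_k(W)\big)\; g_W,\qquad W\in\mathcal{Q}.$$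
   Context: Let $m,n$ be positive integers, and write $A_i$ for the $i$-th row of a matrix $A$, regarded as a column vector. The assignment manifold is $\mathcal{W} = \{W\in\mathbb{R}^{m\times n} : W>0 \text{ entrywise},\ W\mathbf{1}_n=\mathbf{1}_m\}$. All its tangent spaces are identified with $\mathcal{T}_0=\{V\in\mathbb{R}^{m\times n}: V\mathbf{1}_n=0\}$. It carries the Fisher-Rao metric $g_W(U,V)=\sum_{i,j} U_{ij}V_{ij}/W_{ij}$ for $U,V\in\mathcal{T}_0$, and $\|V\|_g^2=g_W(V,V)$. The replicator operator $\mathcal{R}_W\colon\mathbb{R}^{m\times n}\to\mathcal{T}_0$ is defined row-wise by $(\mathcal{R}_W[X])_i = R_{W_i}X_i$ with $R_p=\mathrm{Diag}(p)-pp^\top$. For a probability vector $p\in\mathbb{R}^n$ and $a\in\mathbb{R}^n$, $\mathrm{Var}_p(a)=\sum_j p^j (a^j)^2-\big(\sum_j p^ja^j\big)^2$. The potential is $G(W)=-\tfrac12\sum_{k=1}^m\mathrm{Var}_{W_k}(F_k(W))\le 0$, and $\mathcal{Q}=\{W\in\mathcal{W}: G(W)<0\}$, an open subset of $\mathcal{W}$ (the complement of the set $G^{-1}(0)$ of Mañé critical points). The Jacobi metric is $h_0=(0-G)\,g|_{\mathcal{Q}}$, a Riemannian metric on $\mathcal{Q}$. A critical point of $\mathcal{L}$ is a curve at which the first variation of $\mathcal{L}$ vanishes for all smooth variations through curves in $\mathcal{W}$ with fixed endpoints. *)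

(* Defs.v *)
From HB Require Import structures.
From mathcomp Require Import all_boot all_order all_algebra.
From mathcomp Require Import all_classical all_reals all_analysis.

Set Implicit Arguments.
Unset Strict Implicit.
Unset Printing Implicit Defensive.

Import Order.TTheory GRing.Theory Num.Theory.
Import numFieldNormedType.Exports.

Local Open Scope classical_set_scope.
Local Open Scope ring_scope.

(** * Smooth maps on relatively open sets and on sets with boundary *)

Section Smooth.
Context {R : realType} {V U : normedModType R}.
Implicit Types (A E : set V) (f : V -> U) (x v : V).

(* Same as [derivable] and ['D_v f x] of the library, except that only the
   points x + h v lying in A are used: the derivative is one-sided at an
   endpoint of an interval, and depends only on the restriction of f to A. *)
Definition diff_quotient_within A f x v : set_system U :=
  (fun h : R => h^-1 *: (f (x + h *: v) - f x))
    @ within [set h : R | A (x + h *: v)] 0^'.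

Definition derivable_within A f x v : Prop :=
  cvg (diff_quotient_within A f x v).

Definition derive_within A f v x : U := lim (diff_quotient_within A f x v).

Fixpoint iter_derive_within A f (vs : seq V) : V -> U :=
  if vs is v :: vs' then derive_within A (iter_derive_within A f vs') v
  else f.

(* C^oo on A: all iterated partial derivatives along directions taken in E
   exist and are continuous on A.  E is a set of vectors spanning the tangent
   space of A. *)
Definition smooth_on A E f : Prop :=
  forall vs : seq V, (forall v, v \in vs -> E v) ->
    {within A, continuous (iter_derive_within A f vs)} /\
    forall x v, A x -> E v -> derivable_within A (iter_derive_within A f vs) x v.

End Smooth.

Section Curves.
Context {R : realType} {U : normedModType R}.
Implicit Types (c : R -> U) (a b : R).

Definition smooth_curve a b c : Prop := smooth_on `[a, b] [set 1] c.

Definition velocity a b c (t : R) : U := derive_within `[a, b] c 1 t.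

Definition acceleration a b c (t : R) : U := velocity a b (velocity a b c) t.

End Curves.

(* Orientation-preserving diffeomorphism from [a, b] onto [t0, t1]. *)
Definition reparametrization {R : realType} (a b t0 t1 : R) (phi : R -> R) :=
  [/\ smooth_curve a b phi, phi a = t0, phi b = t1 &
      forall s, s \in `[a, b] -> 0 < velocity a b phi s].

(** * The assignment manifold *)

Section AssignmentManifold.
Context {R : realType} {m n : nat}.
Implicit Types (W U V X : 'M[R]_(m, n)) (F : 'M[R]_(m, n) -> 'M[R]_(m, n)).

Definition assignment_manifold : set 'M[R]_(m, n) :=
  [set W : 'M[R]_(m, n) | (forall i j, 0 < W i j) /\
           W *m (const_mx 1 : 'cV[R]_n) = (const_mx 1 : 'cV[R]_m)].

Definition tangent0 : set 'M[R]_(m, n) :=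
  [set V : 'M[R]_(m, n) | V *m (const_mx 1 : 'cV[R]_n) = (0 : 'cV[R]_m)].

Definition fisher_rao W U V : R :=
  \sum_(i < m) \sum_(j < n) U i j * V i j / W i j.

Definition rowvec X (i : 'I_m) : 'cV[R]_n := (row i X)^T.

Definition replicator_mx (p : 'cV[R]_n) : 'M[R]_n := diag_mx p^T - p *m p^T.

Definition replicator W X : 'M[R]_(m, n) :=
  \matrix_(i, j) (replicator_mx (rowvec W i) *m rowvec X i) j 0.

Definition Var (p a : 'cV[R]_n) : R :=
  \sum_(j < n) p j 0 * a j 0 ^+ 2 - (\sum_(j < n) p j 0 * a j 0) ^+ 2.

Definition potential F W : R :=
  - 2^-1 * \sum_(k < m) Var (rowvec W k) (rowvec (F W) k).

Definition Qset F : set 'M[R]_(m, n) :=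
  [set W | assignment_manifold W /\ potential F W < 0].

Definition jacobi_metric F W U V : R := (0 - potential F W) * fisher_rao W U V.

(* F matters only on the manifold, on which it is smooth in the sense of
   [smooth_on] for the tangent directions. *)
Definition smooth_field F : Prop := smooth_on assignment_manifold tangent0 F.

Definition integral_curve F (t0 t1 : R) (c : R -> 'M[R]_(m, n)) : Prop :=
  forall t, t \in `[t0, t1] ->
    [/\ assignment_manifold (c t),
        derivable_within `[t0, t1] c t 1 &
        velocity t0 t1 c t = replicator (c t) (F (c t))].

(** * Action functional and its critical points *)

Definition action_functional F (t0 t1 : R) (c : R -> 'M[R]_(m, n)) : R :=
  \int[lebesgue_measure]_(t in `[t0, t1])
    (2^-1 * fisher_rao (c t) (velocity t0 t1 c t) (velocity t0 t1 c t)
     + 2^-1 * \sum_(i < m) Var (rowvec (c t) i) (rowvec (F (c t)) i)).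

(* H (s, t), for s in ]-e, e[ and t in [t0, t1], is the variation. *)
Definition fixed_endpoint_variation (t0 t1 : R) (c : R -> 'M[R]_(m, n)) (e : R)
    (H : R * R -> 'M[R]_(m, n)) : Prop :=
  [/\ smooth_on (`]- e, e[%classic `*` `[t0, t1]%classic)
        [set (1, 0); (0, 1)] H,
      forall s t, s \in `]- e, e[ -> t \in `[t0, t1] ->
        assignment_manifold (H (s, t)),
      forall t, t \in `[t0, t1] -> H (0, t) = c t &
      forall s, s \in `]- e, e[ -> H (s, t0) = c t0 /\ H (s, t1) = c t1].

Definition critical_point (L : (R -> 'M[R]_(m, n)) -> R) (t0 t1 : R)
    (c : R -> 'M[R]_(m, n)) : Prop :=
  [/\ smooth_curve t0 t1 c,
      forall t, t \in `[t0, t1] -> assignment_manifold (c t) &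
      forall (e : R) H, 0 < e -> fixed_endpoint_variation t0 t1 c e H ->
        is_derive (0 : R) (1 : R) (fun s : R => L (fun t => H (s, t))) (0 : R)].

(** * Geodesics of a metric on a relatively open subset of the manifold *)

(* All tangent spaces being identified with [tangent0], a connection on Q has
   the form (nabla_X Y)(W) = 'D_(X W) Y W + Gamma W (X W) (Y W), with Gamma W
   bilinear on [tangent0]; it is the Levi-Civita connection of h when it is
   torsion-free (Gamma W symmetric) and compatible with h (tested here on
   constant vector fields U and V, which suffices by bilinearity). *)
Definition levi_civita (Q : set 'M[R]_(m, n))
    (h : 'M[R]_(m, n) -> 'M[R]_(m, n) -> 'M[R]_(m, n) -> R)
    (Gamma : 'M[R]_(m, n) -> 'M[R]_(m, n) -> 'M[R]_(m, n) -> 'M[R]_(m, n)) :=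
  forall W, Q W ->
  [/\ forall U V, tangent0 U -> tangent0 V -> tangent0 (Gamma W U V),
      forall (k : R) U U' V, tangent0 U -> tangent0 U' -> tangent0 V ->
        Gamma W (k *: U + U') V = k *: Gamma W U V + Gamma W U' V,
      forall U V, tangent0 U -> tangent0 V -> Gamma W U V = Gamma W V U &
      forall X U V, tangent0 X -> tangent0 U -> tangent0 V ->
        'D_X (fun W' => h W' U V) W =
          h W (Gamma W X U) V + h W U (Gamma W X V)].

(* The covariant derivative of the velocity along c vanishes identically. *)
Definition geodesic (Q : set 'M[R]_(m, n))
    (h : 'M[R]_(m, n) -> 'M[R]_(m, n) -> 'M[R]_(m, n) -> R)
    (a b : R) (c : R -> 'M[R]_(m, n)) : Prop :=
  [/\ smooth_curve a b c,
      forall s, s \in `[a, b] -> Q (c s) &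
      exists2 Gamma, levi_civita Q h Gamma &
        forall s, s \in `[a, b] ->
          acceleration a b c s
          + Gamma (c s) (velocity a b c s) (velocity a b c s) = 0].

End AssignmentManifold.

(* Main.v *)
Require Import Defs.
From HB Require Import structures.
From mathcomp Require Import all_boot all_order all_algebra.
From mathcomp Require Import all_classical all_reals all_analysis.
From mathcomp Require Import ring lra.
Set Implicit Arguments.
Unset Strict Implicit.
Unset Printing Implicit Defensive.
Import Order.TTheory GRing.Theory Num.Theory.
Import numFieldNormedType.Exports.
Local Open Scope classical_set_scope.
Local Open Scope ring_scope.

(** Along the assignment flow the velocity is R_W[F(W)], so
    rho(W) := 1/2 sum_k Var_{W_k}(F_k(W)) = 1/2 |W'|_g^2: the curve has zero
    energy for the Lagrangian 1/2 |.|_g^2 + rho.  Since W' satisfies a linear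
    differential inequality, Gronwall's lemma shows that rho, which is positive
    at time 0, is positive along the whole curve.  Testing criticality on the
    variations W + s eta V, with V tangent and constant, gives the
    Euler-Lagrange equation W'' + Gamma^g(W', W') = grad rho.  In the parameter
    s with ds/dt = rho(W(t)) this is, by the formula for the Levi-Civita
    connection of the conformal metric rho g and by 2 rho = |W'|_g^2, the
    geodesic equation of rho g. *)

(** * Derivatives within a set *)

(** The manifold has empty interior in the space of matrices and [F] is constrained on it alone, so
    derivatives are taken within sets, along tangent directions. A chain rule then needs a total
    differential, which is not given: it is recovered from the continuity of the derivatives along a
    finite spanning family of tangent matrices, and linearity in the direction comes with it.
    Criticality speaks of smooth variations only, and the geodesic must be smooth too; hence a
    calculus of [Ck] functions closed under every operation that occurs. The differential inequality
    arises because the entries of $R_W[F(W)]$ are functions $X$ of $W$ alone: along the flow $\dot X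
    = dX(\dot W)$, and $\dot W$ is $X$ again, with coefficients bounded on the compact interval. In
    the time parameter the curve is only a pregeodesic: once $|\dot W|_g^2 = 2\rho$ is inserted, the
    gradient terms cancel and the multiple $(d\rho(\dot W)/\rho)\,\dot W$ of the velocity is left.
    Passing to $ds = \rho\,dt$ produces exactly the opposite term. *)

Lemma cvg_sum {R : realType} {T : Type} (F : set_system T) {FF : Filter F} {U : normedModType R}
    (I : Type) (s : seq I) (h : I -> T -> U) (l : I -> U) :
  (forall i, h i @ F --> l i) -> (fun x => \sum_(i <- s) h i x) @ F --> \sum_(i <- s) l i.
Proof.
move=> hl; elim: s => [|i s IH].
  by rewrite big_nil; under eq_fun do rewrite big_nil; exact: cvg_cst.
rewrite big_cons; under eq_fun do rewrite big_cons.
by apply: cvgD => //; exact: hl.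
Qed.

Section WithinDerivative.
Context {R : realType} {V : normedModType R}.
Implicit Types (A : set V) (x v : V).

(** The filter of [diff_quotient_within], named so that it can carry filter instances. It contains
    the empty set when the points of the line near [x], other than [x], miss [A]; limits are unique
    only where [ProperFilter] is established. *)
Definition dir_nbhs A x v : set_system R :=
  within [set h : R | A (x + h *: v)] 0^'.

Global Instance dir_nbhs_filter A x v : Filter (dir_nbhs A x v).
Proof. exact: within_filter. Qed.

Definition has_derivative_within {U : normedModType R} A (f : V -> U) x v (l : U) : Prop :=
  (fun h : R => h^-1 *: (f (x + h *: v) - f x)) @ dir_nbhs A x v --> l.

Lemma dir_nbhs_in A x v : \forall h \near dir_nbhs A x v, A (x + h *: v).
Proof. exact: withinT. Qed.

Lemma dir_nbhs_neq0 A x v : \forall h \near dir_nbhs A x v, h != 0.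
Proof. by apply: cvg_within; exact: (nbhs_dnbhs_neq (0 : R)). Qed.

Lemma cvg_dir_nbhs A x v : (fun h : R => h) @ dir_nbhs A x v --> (0 : R).
Proof.
apply: cvg_within_filter; exact: cvg_within.
Qed.

Lemma cvg_dir_nbhs_to A x v :
  (fun h : R => x + h *: v) @ dir_nbhs A x v --> within A (nbhs x).
Proof.
move=> P /= AP.
have : (fun h : R => x + h *: v) @ dir_nbhs A x v --> x.
  rewrite -[X in _ --> X]addr0; apply: cvgD; first exact: cvg_cst.
  by rewrite -[X in _ --> X](scale0r v); apply: cvgZr_tmp; exact: cvg_dir_nbhs.
move=> /(_ _ AP) H.
by apply: filterS2 (dir_nbhs_in A x v) H => h Ah /(_ Ah).
Qed.

Lemma continuous_within_dir {U : topologicalType} A (f : V -> U) x v :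
  {within A, continuous f} -> A x ->
  (fun h : R => f (x + h *: v)) @ dir_nbhs A x v --> f x.
Proof.
move=> /subspace_continuousP cf Ax.
exact: cvg_comp (@cvg_dir_nbhs_to A x v) (cf x Ax).
Qed.

Arguments continuous_within_dir {U A f x} v _ _.

Lemma near_eq_cvg_to {T : Type} {U : nbhsType} (F : set_system T) {FF : Filter F}
  (f g : T -> U) (l : U) : f @ F --> l -> (\forall t \near F, f t = g t) ->
  g @ F --> l.
Proof. by move=> fl fg; apply: cvg_trans (near_eq_cvg fg) fl. Qed.

Section Rules.
Context {U : normedModType R}.
Implicit Types (f g : V -> U) (l : U).
Local Notation hdw := has_derivative_within.

Lemma has_derivative_within_lim A f x v l : ProperFilter (dir_nbhs A x v) ->
  hdw A f x v l -> derive_within A f v x = l.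
Proof. by move=> pf fl; exact: cvg_lim. Qed.

Lemma has_derivative_within_cvg A f x v l : hdw A f x v l ->
  derivable_within A f x v.
Proof. by move=> fl; apply/cvg_ex; exists l. Qed.

Lemma derivable_withinP A f x v : derivable_within A f x v ->
  hdw A f x v (derive_within A f v x).
Proof. by []. Qed.

Lemma eq_has_derivative_within A f g x v l : A x ->
  (forall y, A y -> f y = g y) -> hdw A f x v l -> hdw A g x v l.
Proof.
move=> Ax fg /near_eq_cvg_to; apply.
have K := dir_nbhs_in A x v.
near=> h; rewrite -!fg//.
by near: h.
Unshelve. all: by end_near. Qed.

Lemma has_derivative_within_cst A (k : U) x v : hdw A (cst k) x v 0.
Proof.
rewrite /hdw /cst; under eq_fun do rewrite subrr scaler0.
exact: cvg_cst.
Qed.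

Lemma has_derivative_withinD A f g x v l k : hdw A f x v l -> hdw A g x v k ->
  hdw A (fun y => f y + g y) x v (l + k).
Proof.
move=> fl gk; apply: near_eq_cvg_to (cvgD fl gk) _.
by apply: nearW => h; rewrite !fctE -scalerDr opprD addrACA.
Qed.

(** The increment is $(a(x+hv)-a(x))\,f(x+hv) + a(x)\,(f(x+hv)-f(x))$; continuity of [f] handles the
    factor $f(x+hv)$. *)
Lemma has_derivative_withinZ A (a : V -> R) f x v (k : R) l :
  {within A, continuous f} -> A x ->
  hdw A a x v k -> hdw A f x v l ->
  hdw A (fun y => a y *: f y) x v (k *: f x + a x *: l).
Proof.
move=> cf Ax ak fl.
apply: near_eq_cvg_to (cvgD (cvgZ ak (continuous_within_dir v cf Ax))
  (cvgZ (cvg_cst (a x)) fl)) _.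
apply: nearW => h; rewrite !fctE.
rewrite !scalerA [a x * _]mulrC -!scalerA -scalerDr scalerBl scalerBr.
by rewrite subrKA.
Qed.

End Rules.

Lemma has_derivative_withinV A (a : V -> R) x v (k : R) :
  {within A, continuous a} -> A x -> a x != 0 ->
  has_derivative_within A a x v k ->
  has_derivative_within A (fun y => (a y)^-1) x v (- k * (a x)^-1 ^+ 2).
Proof.
move=> ca Ax a0 ak.
have ca' := continuous_within_dir v ca Ax.
have nz : \forall h \near dir_nbhs A x v, a (x + h *: v) != 0.
  exact: cvgr_neq0 ca' a0.
rewrite expr2.
apply: near_eq_cvg_to (cvgM (cvgN ak) (cvgM (cvg_cst (a x)^-1) (cvgV a0 ca'))) _.
near=> h; have ah0 : a (x + h *: v) != 0 by near: h.
rewrite !fctE /GRing.scale/=; move: (h^-1) => k'.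
by field; rewrite a0 ah0.
Unshelve. all: by end_near. Qed.

Lemma has_derivative_within_id A x v : has_derivative_within A (fun y => y) x v v.
Proof.
have : (fun h : R => v) @ dir_nbhs A x v --> v by exact: cvg_cst.
move=> /near_eq_cvg_to; apply.
have K := dir_nbhs_neq0 A x v.
near=> h; rewrite addrAC subrr add0r scalerA mulVf ?scale1r//.
by near: h.
Unshelve. all: by end_near. Qed.

(** Fréchet differentiability relative to [A], for an arbitrary candidate [D]: the chain rule asks
    separately for homogeneity of [D] and for its continuity at one vector. *)
Definition linear_approx {U : normedModType R} A (f : V -> U) x (D : V -> U) :=
  forall e : R, 0 < e -> \forall y \near within A (nbhs x),
    `|f y - f x - D (y - x)| <= e * `|y - x|.

End WithinDerivative.

(** The difference quotient of [f \o g] is [D] applied to that of [g], plus a remainder [r]. The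
    former tends to [D l] by continuity; the latter is at most $\varepsilon$ times the quotient of
    [g], which is eventually bounded by $|l|+1$ because it converges. *)
Lemma has_derivative_within_comp {R : realType} {V V' U : normedModType R}
    (A : set V) (B : set V') (g : V -> V') (f : V' -> U) x v (l : V') (D : V' -> U) :
  A x -> {within A, continuous g} -> (forall y, A y -> B (g y)) ->
  has_derivative_within A g x v l -> linear_approx B f (g x) D ->
  (forall (a : R) w, D (a *: w) = a *: D w) -> {for l, continuous D} ->
  has_derivative_within A (f \o g) x v (D l).
Proof.
move=> Ax cg AB gl fD Dl cD.
rewrite /has_derivative_within.
have H1 : (fun h : R => D (h^-1 *: (g (x + h *: v) - g x))) @ dir_nbhs A x v --> D l.
  exact: cvg_comp gl cD.
rewrite -[X in _ --> X]addr0.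
pose r h := h^-1 *: (f (g (x + h *: v)) - f (g x) - D (g (x + h *: v) - g x)).
have H2 : r @ dir_nbhs A x v --> (0 : U).
  apply/cvgr0Pnorm_le => e e0.
  have e1 : 0 < e / (`|l| + 1) by apply: divr_gt0 => //; rewrite ltr_wpDl.
  have gB : (fun h : R => g (x + h *: v)) @ dir_nbhs A x v --> within B (nbhs (g x)).
    move=> P /= BP.
    have := continuous_within_dir v cg Ax BP => H.
    by apply: filterS2 (dir_nbhs_in A x v) H => h /AB Bh /(_ Bh).
  have N1 := gB _ (fD _ e1).
  have N2 : \forall h \near dir_nbhs A x v, `|h^-1 *: (g (x + h *: v) - g x)| <= `|l| + 1.
    by apply: cvgr_norm_le gl _ _; rewrite ltrDl.
  near=> h.
  rewrite /r normrZ.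
  have M1 : `|f (g (x + h *: v)) - f (g x) - D (g (x + h *: v) - g x)| <=
     e / (`|l| + 1) * `|g (x + h *: v) - g x|.
    near: h; exact: N1.
  have M2 : `|h^-1| * `|g (x + h *: v) - g x| <= `|l| + 1.
    rewrite -normrZ; near: h; exact: N2.
  apply: (@le_trans _ _ (`|h^-1| * (e / (`|l| + 1) * `|g (x + h *: v) - g x|))).
    by rewrite ler_wpM2l.
  rewrite mulrCA (le_trans (ler_wpM2l _ M2)) ?(ltW e1)//.
  by rewrite divfK// gt_eqF// ltr_wpDl.
apply: near_eq_cvg_to (cvgD H1 H2) _.
by apply: nearW => h; rewrite !fctE /r Dl -scalerDr addrC subrK.
Unshelve. all: by end_near. Qed.

(** * Functions of class C^k within a set *)

Section Ck.
Context {R : realType} {V : normedModType R}.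
Implicit Types (A E : set V).
Local Notation hdw := has_derivative_within.

(* C^k on A in the directions E.  The derivatives are only constrained on A, so
   that, unlike for [iter_derive_within], no junk value off A has to be matched
   when a closure property is proved. *)
Fixpoint Ck {U : normedModType R} A E (k : nat) (f : V -> U) : Prop :=
  {within A, continuous f} /\
  if k is k'.+1 then
    forall v, E v -> exists2 g, (forall x, A x -> hdw A f x v (g x)) & Ck A E k' g
  else True.

Lemma continuous_withinD {U : normedModType R} A (f g : V -> U) :
  {within A, continuous f} -> {within A, continuous g} ->
  {within A, continuous (fun y => f y + g y)}.
Proof.
move=> /subspace_continuousP cf /subspace_continuousP cg.
by apply/subspace_continuousP => x Ax; apply: cvgD; [exact: cf|exact: cg].
Qed.

Lemma continuous_withinZ {U : normedModType R} A (a : V -> R) (f : V -> U) :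
  {within A, continuous a} -> {within A, continuous f} ->
  {within A, continuous (fun y => a y *: f y)}.
Proof.
move=> /subspace_continuousP cf /subspace_continuousP cg.
by apply/subspace_continuousP => x Ax; apply: cvgZ; [exact: cf|exact: cg].
Qed.

Lemma continuous_withinV A (a : V -> R) : (forall x, A x -> a x != 0) ->
  {within A, continuous a} -> {within A, continuous (fun y => (a y)^-1)}.
Proof.
move=> a0 /subspace_continuousP cf.
by apply/subspace_continuousP => x Ax; apply: cvgV; [exact: a0|exact: cf].
Qed.

Lemma eq_continuous_within {U : normedModType R} A (f g : V -> U) :
  (forall x, A x -> f x = g x) ->
  {within A, continuous f} -> {within A, continuous g}.
Proof.
move=> fg /subspace_continuousP cf; apply/subspace_continuousP => x Ax.
have H : f @ within A (nbhs x) --> g x by rewrite -(fg _ Ax); exact: cf.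
apply: near_eq_cvg_to H _.
have : \forall y \near within A (nbhs x), A y by exact: withinT.
by apply: filterS => y /fg.
Qed.

Lemma continuous_within_comp {V' U : normedModType R} A (B : set V')
    (g : V -> V') (f : V' -> U) :
  {within A, continuous g} -> {within B, continuous f} -> (forall x, A x -> B (g x)) ->
  {within A, continuous (f \o g)}.
Proof.
move=> /subspace_continuousP cg /subspace_continuousP cf AB.
apply/subspace_continuousP => x Ax.
refine (cvg_comp g f _ (cf _ (AB _ Ax))) => P /= BP.
have H : \forall y \near within A (nbhs x), A y by exact: withinT.
by apply: filterS2 H (cg _ Ax _ BP) => y /AB By /(_ By).
Qed.

Section ContinuityOfCk.
Context {U : normedModType R}.
Implicit Types (f g : V -> U).

Lemma Ck_continuous A E k f : Ck A E k f -> {within A, continuous f}.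
Proof. by case: k => [|k] []. Qed.

Lemma Ck_pred A E k f : Ck A E k.+1 f -> Ck A E k f.
Proof.
elim: k f => [|k IH] f [cf H]; split => // v Ev.
by have [g fg Cg] := H v Ev; exists g => //; exact: IH.
Qed.

End ContinuityOfCk.

Section Closure.
Context {U : normedModType R}.
Implicit Types (f g : V -> U).

Lemma eq_Ck A E k f g : (forall x, A x -> f x = g x) -> Ck A E k f -> Ck A E k g.
Proof.
move=> fg Cf; have cg := eq_continuous_within fg (Ck_continuous Cf).
case: k Cf => [//|k] [_ H]; split => // v Ev.
have [d fd Cd] := H v Ev; exists d => // x Ax.
exact: eq_has_derivative_within Ax fg (fd _ Ax).
Qed.

Lemma Ck_cst A E k (c : U) : Ck A E k (fun=> c).
Proof.
elim: k c => [|k IH] c;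
  (split; first by apply/subspace_continuousP => x Ax; exact: cvg_cst) => // v Ev.
by exists (fun=> 0) => // x Ax; exact: has_derivative_within_cst.
Qed.

Lemma CkD A E k f g : Ck A E k f -> Ck A E k g -> Ck A E k (fun x => f x + g x).
Proof.
elim: k f g => [|k IH] f g [cf Hf] [cg Hg]; (split; first exact: continuous_withinD) => // v Ev.
have [df fdf Cdf] := Hf v Ev; have [dg gdg Cdg] := Hg v Ev.
exists (fun x => df x + dg x); last exact: IH.
by move=> x Ax; apply: has_derivative_withinD; [exact: fdf|exact: gdg].
Qed.

Lemma CkZ A E k (a : V -> R) f :
  Ck A E k a -> Ck A E k f -> Ck A E k (fun x => a x *: f x).
Proof.
elim: k a f => [|k IH] a f Ca Cf;
  (split; first by apply: continuous_withinZ;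
    [exact: Ck_continuous Ca|exact: Ck_continuous Cf]) => // v Ev.
have [da ada Cda] := Ca.2 v Ev; have [df fdf Cdf] := Cf.2 v Ev.
exists (fun x => da x *: f x + a x *: df x).
  move=> x Ax; apply: has_derivative_withinZ (ada _ Ax) (fdf _ Ax) => //.
  exact: Ck_continuous Cf.
by apply: CkD; apply: IH => //; exact: Ck_pred.
Qed.

Lemma Ck_sum A E k (I : Type) (s : seq I) (P : pred I) (f : I -> V -> U) :
  (forall i, P i -> Ck A E k (f i)) -> Ck A E k (fun x => \sum_(i <- s | P i) f i x).
Proof.
move=> Cf; elim: s => [|i s IH].
  by apply: eq_Ck (Ck_cst A E k 0) => x _; rewrite big_nil.
have [Pi|nPi] := boolP (P i).
  by apply: eq_Ck (CkD (Cf _ Pi) IH) => x _; rewrite big_cons Pi.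
by apply: eq_Ck IH => x _; rewrite big_cons (negbTE nPi).
Qed.

(** Properness makes limits unique, so the derivatives chosen in [Ck] agree on [A] with
    [derive_within]; their disagreement off [A] is absorbed by [eq_Ck]. *)
Lemma smooth_onP A E f : (forall x v, A x -> E v -> ProperFilter (dir_nbhs A x v)) ->
  smooth_on A E f <-> forall k, Ck A E k f.
Proof.
move=> pf; split.
  move=> sf k; elim: k f sf => [|k IH] f sf.
    by split => //; have [] := sf [::] (fun _ => ltac:(by [])).
  split; first by have [] := sf [::] (fun _ => ltac:(by [])).
  move=> v Ev; exists (derive_within A f v).
    move=> x Ax; apply: derivable_withinP.
    by have [_ /(_ x v Ax Ev)] := sf [::] (fun _ => ltac:(by [])).
  apply: IH => vs vsE.
  (* The head of the list is the outermost derivative, so the direction in which [f] is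
     differentiated first goes to the end. *)
  have -> : iter_derive_within A (derive_within A f v) vs = iter_derive_within A f (rcons vs v).
    by elim: (vs) => //= w ws ->.
  apply: sf => w; rewrite mem_rcons inE => /orP[/eqP->//|/vsE//].
move=> Cf vs vsE.
have {}Cf : forall k, Ck A E k (iter_derive_within A f vs).
  elim: vs vsE => [//|v vs IH] vsE k /=.
  have Ev : E v by apply: vsE; rewrite mem_head.
  have [_ /(_ v Ev) [g fg Cg]] :=
    IH (fun w ws => ltac:(by apply: vsE; rewrite inE ws orbT)) k.+1.
  apply: eq_Ck Cg => x Ax; symmetry.
  by have := pf _ _ Ax Ev => ?; exact: has_derivative_within_lim (fg _ Ax).
split; first by have [] := Cf 0.
move=> x v Ax Ev; have [_ /(_ v Ev) [g fg _]] := Cf 1%N.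
exact: has_derivative_within_cvg (fg _ Ax).
Qed.

End Closure.

Lemma Ck_linear {U U' : normedModType R} A E k (L : {linear U -> U'}) (f : V -> U) :
  continuous L -> Ck A E k f -> Ck A E k (L \o f).
Proof.
move=> cL; elim: k f => [|k IH] f [/subspace_continuousP cf H].
  split=> //; apply/subspace_continuousP => x Ax.
  exact: cvg_comp (cf _ Ax) (cL _).
split; first by apply/subspace_continuousP => x Ax; exact: cvg_comp (cf _ Ax) (cL _).
move=> v Ev; have [g fg Cg] := H v Ev; exists (L \o g); last exact: IH.
move=> x Ax.
have HL : (fun h => L (h^-1 *: (f (x + h *: v) - f x))) @ dir_nbhs A x v --> L (g x).
  exact: cvg_comp (fg _ Ax) (cL (g x)).
apply: near_eq_cvg_to HL _.
by apply: nearW => h; rewrite /= linearZ linearB.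
Qed.

Lemma CkM A E k (f g : V -> R) : Ck A E k f -> Ck A E k g -> Ck A E k (fun x => f x * g x).
Proof. exact: CkZ. Qed.

Lemma CkN A E k (f : V -> R) : Ck A E k f -> Ck A E k (fun x => - f x).
Proof.
move=> Cf; have C1 : Ck A E k (fun=> -1 : R) by exact: Ck_cst.
apply: eq_Ck (CkM C1 Cf) => x _.
by rewrite mulN1r.
Qed.

(** The derivative $-a'\,a^{-2}$ involves $a^{-1}$ again, but only to one order less, so induction
    on the order closes. *)
Lemma CkV A E k (a : V -> R) : (forall x, A x -> a x != 0) -> Ck A E k a ->
  Ck A E k (fun x => (a x)^-1).
Proof.
move=> a0; elim: k => [|k IH] Ca;
  (split; first by apply: continuous_withinV => //; exact: Ck_continuous Ca) => // v Ev.
have [da ada Cda] := Ca.2 v Ev.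
exists (fun x => - da x * (a x)^-1 ^+ 2).
  move=> x Ax; apply: has_derivative_withinV (ada _ Ax) => //; last exact: a0.
  exact: Ck_continuous Ca.
apply: CkM; first exact: CkN.
by apply: CkM; apply: IH; exact: Ck_pred.
Qed.

Lemma Ck_id E k (A : set V) : Ck A E k (fun x => x).
Proof.
have c : {within A, continuous (fun x : V => x)}.
  by apply/subspace_continuousP => x Ax; exact: cvg_within.
case: k => [|k]; split => // v Ev; exists (fun=> v); last exact: Ck_cst.
by move=> x Ax; exact: has_derivative_within_id.
Qed.

End Ck.

(** In one variable the convergence of the difference quotient is already a total differential:
    multiply the estimate by $|h|$. *)
Lemma linear_approx1 {R : realType} {U : normedModType R} (B : set R) (f : R -> U) x l :
  has_derivative_within B f x 1 l -> linear_approx B f x (fun w => w *: l).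
Proof.
move=> fl e e0.
have /cvgrPdistC_le /(_ e e0) := fl.
move=> H.
have {}H : \forall h \near (0 : R)^', B (x + h *: 1) ->
   `|h^-1 *: (f (x + h *: 1) - f x) - l| <= e by exact: H.
have {}H : \forall h \near (0 : R), B (x + h) -> `|f (x + h) - f x - h *: l| <= e * `|h|.
  have {}H : \forall h \near (0 : R), h != 0 -> B (x + h *: 1) ->
   `|h^-1 *: (f (x + h *: 1) - f x) - l| <= e by exact: H.
  apply: filterS H => h H Bh.
  have [->|h0] := eqVneq h 0; first by rewrite addr0 subrr scale0r subrr !normr0 mulr0.
  have := H h0; rewrite scaler1 => /(_ Bh).
  rewrite -(ler_pM2r (x := `|h|)) ?normr_gt0// mulrC -normrZ scalerBr scalerA divff// scale1r.
  by [].
have {}H : \forall y \near x, B (x + (y - x)) ->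
    `|f (x + (y - x)) - f x - (y - x) *: l| <= e * `|y - x|.
  have K : (y - x) @[y --> x] --> (0 : R).
    by rewrite -[X in _ --> X](subrr x); apply: cvgB => //; exact: cvg_cst.
  exact: K _ H.
apply: filterS H => y /=; by rewrite [x + _]addrC subrK.
Qed.

Lemma has_derivative_within_comp_curve {R : realType} {V U : normedModType R}
    (A : set V) (B : set R) (f : R -> U) (g : V -> R) x v dg df :
  A x -> (forall y, A y -> B (g y)) -> {within A, continuous g} ->
  has_derivative_within A g x v dg -> has_derivative_within B f (g x) 1 df ->
  has_derivative_within A (f \o g) x v (dg *: df).
Proof.
move=> Ax AB cg gd fd.
apply: (has_derivative_within_comp (B := B) (l := dg) (D := fun w => w *: df)) => //.
- exact: linear_approx1.
- by move=> a w; rewrite scalerA.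
- by apply: cvgZr_tmp; exact: cvg_id.
Qed.

Lemma Ck_comp_curve {R : realType} {V U : normedModType R} (A E : set V) (B : set R) k
    (f : R -> U) (g : V -> R) :
  (forall x, A x -> B (g x)) -> Ck A E k g -> Ck B [set 1] k f -> Ck A E k (f \o g).
Proof.
move=> AB; elim: k f => [|k IH] f Cg Cf;
  (split; first by exact: continuous_within_comp (Ck_continuous Cg) (Ck_continuous Cf) AB) => // v Ev.
have [dg gdg Cdg] := Cg.2 v Ev; have [df fdf Cdf] := Cf.2 1 erefl.
exists (fun x => dg x *: (df \o g) x); last first.
  by apply: CkZ => //; apply: IH => //; exact: Ck_pred.
move=> x Ax; apply: (has_derivative_within_comp_curve (B := B)) => //.
- exact: Ck_continuous Cg.
- exact: gdg.
- by apply: fdf; exact: AB.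
Qed.

(** * Functions on the assignment manifold *)

Section Manifold.
Context {R : realType} {m n : nat}.
Local Notation M := (@assignment_manifold R m n).
Local Notation T0 := (@tangent0 R m n).
Local Notation mat := 'M[R]_(m, n).
Implicit Types (W U V X : mat).
Local Notation hdw := has_derivative_within.

Lemma tangent0P V : T0 V <-> forall i, \sum_j V i j = 0.
Proof.
split=> [/matrixP H i|H].
  have := H i 0; rewrite !mxE => Hi; rewrite -[RHS]Hi; apply: eq_bigr => j _.
  by rewrite mxE mulr1.
apply/matrixP => i k; rewrite !mxE -[RHS](H i); apply: eq_bigr => j _.
by rewrite mxE mulr1.
Qed.

Lemma assignment_manifoldP W :
  M W <-> (forall i j, 0 < W i j) /\ (forall i, \sum_j W i j = 1).
Proof.
split=> -[W0 H]; split=> //.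
  move=> i; have /matrixP/(_ i 0) := H; rewrite !mxE => Hi; rewrite -[RHS]Hi; apply: eq_bigr => j _.
  by rewrite mxE mulr1.
apply/matrixP => i k; rewrite !mxE -[RHS](H i); apply: eq_bigr => j _.
by rewrite mxE mulr1.
Qed.

Lemma tangent0_lin (a : R) U V : T0 U -> T0 V -> T0 (a *: U + V).
Proof. by rewrite /tangent0 /= => TU TV; rewrite mulmxDl -scalemxAl TU TV scaler0 addr0. Qed.

Lemma tangent0_0 : T0 0.
Proof. by rewrite /tangent0 /= mul0mx. Qed.

Lemma tangent0Z (a : R) V : T0 V -> T0 (a *: V).
Proof. by move=> TV; rewrite -[_ *: _]addr0; apply: tangent0_lin tangent0_0. Qed.

Lemma tangent0D U V : T0 U -> T0 V -> T0 (U + V).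
Proof. by move=> TU TV; rewrite -[U]scale1r; apply: tangent0_lin. Qed.

Lemma tangent0_sum (I : Type) (s : seq I) (P : pred I) (f : I -> mat) :
  (forall i, P i -> T0 (f i)) -> T0 (\sum_(i <- s | P i) f i).
Proof. by move=> Tf; apply: big_ind => //; [exact: tangent0_0|exact: tangent0D]. Qed.

Lemma tangent0_sub W W' : M W -> M W' -> T0 (W' - W).
Proof.
move=> [_ H] [_ H']; rewrite /tangent0 /= mulmxBl.
by rewrite H H' subrr.
Qed.

Lemma le_mx_norm_entry X i j : `|X i j| <= `|X|.
Proof.
rewrite -[`|X|]/(mx_norm X) mx_normrE.
exact: (le_bigmax _ (fun ij : 'I_m * 'I_n => `|X ij.1 ij.2|) (i, j)).
Qed.

(** The radius is the smallest entry of [W], capped by 1: in the sup norm a smaller perturbation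
    keeps all entries positive, and a tangent one keeps the row sums. *)
Lemma assignment_manifold_open W : M W ->
  exists2 d : R, 0 < d & forall V, T0 V -> `|V| < d -> M (W + V).
Proof.
move=> [W0 W1].
pose d := \big[Num.min/1]_(ij : 'I_m * 'I_n) W ij.1 ij.2.
exists d; first by apply: lt_bigmin => // ij _; exact: W0.
move=> V TV Vd; split; last by rewrite mulmxDl W1 TV addr0.
move=> i j; rewrite mxE.
have : `|V i j| < W i j.
  apply: (le_lt_trans (le_mx_norm_entry V i j)); apply: (lt_le_trans Vd).
  exact: (bigmin_le 1 (i, j) (fun ij : 'I_m * 'I_n => W ij.1 ij.2)).
by rewrite ltr_norml => /andP[H1 _]; rewrite -ltrBlDl sub0r.
Qed.

Lemma assignment_manifold_near W V : M W -> T0 V ->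
  \forall h \near (0 : R), M (W + h *: V).
Proof.
move=> MW TV; have [d d0 H] := assignment_manifold_open MW.
have : (fun h : R => h *: V) @ (0 : R) --> (0 : mat).
  by rewrite -[X in _ --> X](scale0r V); apply: cvgZr_tmp; exact: cvg_id.
move=> /cvgr0_norm_lt /(_ _ d0); apply: filterS => h hd.
by apply: H => //; exact: tangent0Z.
Qed.

(** Since short tangent segments stay in the manifold, derivatives within it are ordinary two-sided
    ones. This yields both the uniqueness of limits and the passage to the library derivative, hence
    to the mean value theorem. *)
Lemma dir_nbhs_manifold W V (P : set R) : M W -> T0 V ->
  dir_nbhs M W V P <-> (0 : R)^' P.
Proof.
move=> MW TV; split; last by move=> H; exact: (@cvg_within _ (0:R)^' _ [set h | M (W + h *: V)] P H).
have H : \forall h \near (0 : R)^', M (W + h *: V).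
  by apply: cvg_within; exact: assignment_manifold_near.
move=> K; have {}K : \forall h \near (0 : R)^', M (W + h *: V) -> P h by exact: K.
suff : \forall h \near (0 : R)^', P h by [].
by apply: filterS2 K H => h K Mh; exact: K.
Qed.

Global Instance dir_nbhs_manifold_proper W V : M W -> T0 V -> ProperFilter (dir_nbhs M W V).
Proof.
move=> MW TV; apply: Build_ProperFilter_ex => P /dir_nbhs_manifold -/(_ MW TV) NP.
exact: filter_ex NP.
Qed.

Definition entry (i : 'I_m) (j : 'I_n) (X : mat) : R := X i j.

Fact entry_is_linear i j : linear (entry i j).
Proof. by move=> a X Y; rewrite /entry !mxE. Qed.

HB.instance Definition _ i j := GRing.isLinear.Build R mat R _ (entry i j) (entry_is_linear i j).

Lemma Ck_entry {V0 : normedModType R} (A E : set V0) k (f : V0 -> mat) i j :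
  Ck A E k f -> Ck A E k (fun x => f x i j).
Proof. by move=> Cf; apply: (Ck_linear (L := entry i j)) Cf; exact: coord_continuous. Qed.

(** Here [const_mx 1] is the square all-ones matrix of size [n]: this is the Euclidean orthogonal
    projection onto the tangent space, which subtracts from each row its mean. *)
Definition tangent_proj X : mat := X - n%:R^-1 *: (X *m const_mx 1).

(* A spanning family of the tangent space, but not a basis: for each row the sum
   of its members is 0. *)
Definition tangent_gen (k : 'I_m * 'I_n) : mat := tangent_proj (delta_mx k.1 k.2).

Lemma tangent_gen_tangent k : T0 (tangent_gen k).
Proof.
have n0 : n%:R != 0 :> R by case: k => i [j /= jn]; rewrite pnatr_eq0; case: (n) jn.
apply/tangent0P => i; rewrite /tangent_gen /tangent_proj.
under eq_bigr do rewrite !mxE.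
rewrite big_split/= sumrN; apply/eqP; rewrite subr_eq0; apply/eqP.
rewrite -mulr_sumr.
under [in RHS]eq_bigr do (under eq_bigr do rewrite [const_mx _ _ _]mxE mulr1).
rewrite sumr_const card_ord -[X in _ * X]mulr_natl mulrA mulVf// mul1r.
by apply: eq_bigr => j _; rewrite mxE.
Qed.

(** The projection is linear and fixes [V]; applying it to the expansion of [V] in matrix units
    shows that the entries of [V] themselves serve as coefficients, although the family is not
    free. *)
Lemma tangent_gen_span V : T0 V -> V = \sum_k V k.1 k.2 *: tangent_gen k.
Proof.
move=> TV.
have PV : tangent_proj V = V.
  rewrite /tangent_proj (_ : V *m _ = 0) ?scaler0 ?subr0//.
  apply/matrixP => i k; rewrite !mxE; have /tangent0P/(_ i) Vi := TV; rewrite -[RHS]Vi.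
  by apply: eq_bigr => j _; rewrite mxE mulr1.
have PD X Y (a : R) : tangent_proj (a *: X + Y) = a *: tangent_proj X + tangent_proj Y.
  rewrite /tangent_proj mulmxDl -scalemxAl !scalerDr scalerN !scalerA.
  by rewrite [_ * a]mulrC opprD addrACA.
have P0 : tangent_proj 0 = 0 by rewrite /tangent_proj mul0mx scaler0 subr0.
rewrite -{1}PV {1}(matrix_sum_delta V) pair_big/=.
elim/big_rec2: _ => // k Y1 Y2 _ <-.
by rewrite PD.
Qed.

End Manifold.

(** * Total differentials on the manifold from continuous directional derivatives *)

Section Differentiability.
Context {R : realType} {m n : nat}.
Local Notation M := (@assignment_manifold R m n).
Local Notation T0 := (@tangent0 R m n).
Local Notation mat := 'M[R]_(m, n).
Implicit Types (W U V X : mat).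
Local Notation hdw := has_derivative_within.

Lemma is_derive_line (f : mat -> R) W V l : M W -> T0 V -> hdw M f W V l ->
  is_derive (0 : R) (1 : R) (fun t : R => f (W + t *: V)) l.
Proof.
move=> MW TV fl.
have H : (fun h : R => h^-1 *: (f (W + h *: V) - f W)) @ (0 : R)^' --> l.
  by move=> P /fl /(dir_nbhs_manifold _ MW TV).
have K : (fun h : R => h^-1 *: (f (W + (h *: 1 + 0) *: V) - f (W + 0 *: V))) @ (0 : R)^' --> l.
  by under eq_fun do rewrite [_ *: (1 : R)]mulr1 addr0 scale0r addr0.
by apply: DeriveDef; [apply/cvg_ex; exists l|exact: cvg_lim K].
Qed.

Lemma is_derive_line_at (f : mat -> R) W V l (t : R) : M (W + t *: V) -> T0 V ->
  hdw M f (W + t *: V) V l ->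
  is_derive t (1 : R) (fun t : R => f (W + t *: V)) l.
Proof.
move=> MW TV /(is_derive_line MW TV) [dl dE].
have E (h : R) : f (W + t *: V + h *: V) = f (W + (h + t) *: V).
  by rewrite -addrA -scalerDl [t + h]addrC.
have EE : (fun h : R => h^-1 *:
    (((fun t0 : R => f (W + t *: V + t0 *: V)) \o shift 0) (h *: 1)
     - f (W + t *: V + 0 *: V))) =
  (fun h : R => h^-1 *:
    (((fun t0 : R => f (W + t0 *: V)) \o shift t) (h *: 1) - f (W + t *: V))).
  by apply/funext => h /=; rewrite !E !add0r addr0 //.
apply: DeriveDef; first by move: dl; rewrite /derivable EE.
by move: dE; rewrite /derive EE.
Qed.

(** The step [c] may have either sign, since it will be an entry of a tangent matrix; hence the
    bound on [t] by absolute values. *)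
Lemma mean_value_manifold (f : mat -> R) (g : mat -> R) W V (c : R) : T0 V ->
  (forall t : R, `|t| <= `|c| -> M (W + t *: V)) ->
  (forall X, M X -> hdw M f X V (g X)) ->
  exists2 t : R, `|t| <= `|c| & f (W + c *: V) - f W = c * g (W + t *: V).
Proof.
move=> TV MW fg.
have D (t : R) : `|t| <= `|c| -> is_derive t (1 : R) (fun t : R => f (W + t *: V)) (g (W + t *: V)).
  by move=> tc; apply: is_derive_line_at => //; [exact: MW|apply: fg; exact: MW].
have mvt a b : a <= b -> (forall t, t \in `[a, b] -> `|t| <= `|c|) ->
  exists2 t, t \in `[a, b] & f (W + b *: V) - f (W + a *: V) = g (W + t *: V) * (b - a).
  move=> ab abc; apply: (@MVT_segment R (fun t : R => f (W + t *: V)) (fun t => g (W + t *: V))) => //.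
    by move=> t tab; apply: D; apply: abc; exact: subset_itv_oo_cc.
  apply: derivable_within_continuous => t tab.
  by have := D t (abc _ tab) => -[].
have [c0|c0] := leP 0 c.
  have [|t tc E] := mvt 0 c c0.
    by move=> t; rewrite in_itv/= => /andP[t0 tc]; rewrite !ger0_norm.
  exists t; first by move: tc; rewrite in_itv/= => /andP[t0 tc]; rewrite !ger0_norm.
  by move: E; rewrite scale0r addr0 subr0 mulrC.
have [|t tc E] := mvt c 0 (ltW c0).
  by move=> t; rewrite in_itv/= => /andP[tc t0]; rewrite !ler0_norm ?lerN2// ltW.
exists t; first by move: tc; rewrite in_itv/= => /andP[tc t0]; rewrite !ler0_norm ?lerN2// ltW.
move: E; rewrite scale0r addr0 sub0r mulrN => /eqP.
by rewrite -eqr_oppLR opprB mulrC => /eqP.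
Qed.

Lemma continuous_lincomb (a : 'I_m * 'I_n -> R) :
  continuous (fun V : mat => \sum_k V k.1 k.2 * a k).
Proof.
move=> V; apply: (@cvg_sum R mat (nbhs V) (nbhs_filter V) R) => k.
by apply: cvgM; [exact: coord_continuous|exact: cvg_cst].
Qed.

Section C1.
Variables (f : mat -> R) (g : mat -> mat -> R).
Hypothesis fg : forall V, T0 V -> forall W, M W -> hdw M f W V (g V W).
Hypothesis cg : forall V, T0 V -> {within M, continuous (g V)}.

(* The increment of f is telescoped along the directions [tangent_gen k], to each
   of which the mean value theorem applies. *)
Let approx_sum W (d e : R) (s : seq ('I_m * 'I_n)) (b : 'I_m * 'I_n -> R) : M W ->
  (forall V, T0 V -> `|V| < d -> M (W + V) /\
    forall k, `|g (tangent_gen k) (W + V) - g (tangent_gen k) W| <= e) ->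
  \sum_(k <- s) `|b k| * `|tangent_gen k : mat| < d ->
  `|f (W + \sum_(k <- s) b k *: tangent_gen k) - f W
      - \sum_(k <- s) b k * g (tangent_gen k) W| <= e * \sum_(k <- s) `|b k|.
Proof.
move=> MW H; elim: s => [|k s IH]; first by rewrite !big_nil addr0 !subrr normr0 mulr0.
rewrite !big_cons => sd.
have ss V (t : R) : V = \sum_(k <- s) b k *: tangent_gen k -> `|t| <= `|b k| ->
  T0 (V + t *: tangent_gen k) /\ `|V + t *: tangent_gen k| < d.
  move=> -> tb; split.
    apply: tangent0D; last by apply: tangent0Z; exact: tangent_gen_tangent.
    by apply: tangent0_sum => i _; apply: tangent0Z; exact: tangent_gen_tangent.
  apply: le_lt_trans sd; apply: (le_trans (ler_normD _ _)); rewrite [leRHS]addrC.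
  rewrite lerD//; last by rewrite normrZ ler_wpM2r.
  apply: (le_trans (ler_norm_sum _ _ _)).
  by apply: ler_sum => i _; rewrite normrZ.
set V := \sum_(k <- s) b k *: tangent_gen k in ss *.
have [t tb E] := @mean_value_manifold f (g (tangent_gen k)) (W + V) (tangent_gen k) (b k)
  (tangent_gen_tangent k)
  (fun t tb => ltac:(rewrite -addrA; exact: (H _ (ss V t erefl tb).1 (ss V t erefl tb).2).1))
  (fg (tangent_gen_tangent k)).
have -> : W + (b k *: tangent_gen k + V) = W + V + b k *: tangent_gen k.
  by rewrite -addrA [V + _]addrC.
have /IH {}IH : \sum_(k <- s) `|b k| * `|tangent_gen k : mat| < d.
  by apply: le_lt_trans sd; rewrite lerDr mulr_ge0.
have -> : f (W + V + b k *: tangent_gen k) - f W -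
  (b k * g (tangent_gen k) W + \sum_(j <- s) b j * g (tangent_gen j) W) =
  (b k * (g (tangent_gen k) (W + V + t *: tangent_gen k) - g (tangent_gen k) W)) +
  (f (W + V) - f W - \sum_(j <- s) b j * g (tangent_gen j) W).
  rewrite mulrBr -E; ring.
apply: (le_trans (ler_normD _ _)); rewrite [leRHS]mulrDr lerD//.
rewrite normrM mulrC ler_wpM2r// -addrA.
have [T1 N1] := ss V t erefl tb.
by have [_ /(_ k)] := H _ T1 N1.
Qed.

Lemma linear_approx_manifold W : M W ->
  linear_approx M f W (fun V => \sum_k V k.1 k.2 * g (tangent_gen k) W).
Proof.
move=> MW e e0.
(* The sum of the absolute values of the entries of [V] is at most [N] times the sup norm; the added
   1 keeps [N] positive for empty matrices. *)
pose N := #|{: 'I_m * 'I_n}|%:R + 1 : R.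
have N0 : 0 < N by rewrite ltr_wpDl.
have e1 : 0 < e / N by rewrite divr_gt0.
have [d1 d10 H1] := assignment_manifold_open MW.
have H2 : \forall Y \near (W : mat), forall k : 'I_m * 'I_n, M Y ->
    `|g (tangent_gen k) Y - g (tangent_gen k) W| <= e / N.
  apply: (@filter_forall mat _ (fun k Y => M Y ->
    `|g (tangent_gen k) Y - g (tangent_gen k) W| <= e / N) (nbhs W)).
  move=> k; have /subspace_continuousP /(_ _ MW) := cg (tangent_gen_tangent k).
  by move=> /cvgrPdistC_le /(_ _ e1).
have [d2 /= d20 {}H2] : exists2 d2 : R, 0 < d2 & forall Y, `|Y - W| < d2 ->
    forall k : 'I_m * 'I_n, M Y -> `|g (tangent_gen k) Y - g (tangent_gen k) W| <= e / N.
  move/nbhs_ballP : H2 => [d2 /= d20 H2]; exists d2 => // Y Yd; apply: H2.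
  by rewrite -ball_normE /= distrC.
pose d := Num.min d1 d2.
have H V : T0 V -> `|V| < d -> M (W + V) /\
    forall k, `|g (tangent_gen k) (W + V) - g (tangent_gen k) W| <= e / N.
  rewrite lt_min => TV /andP[V1 V2]; have MV := H1 _ TV V1; split => // k.
  by apply: H2 => //; rewrite addrAC subrr add0r.
(* With $|Y-W| < d/K$, every intermediate point of the telescoping path stays within [d] of [W],
   because each coefficient is bounded by $|Y-W|$. *)
pose K := \sum_(k : 'I_m * 'I_n) `|tangent_gen k : mat| + 1 : R.
have K0 : 0 < K by rewrite ltr_wpDl// sumr_ge0.
have dK : 0 < d / K by rewrite divr_gt0// lt_min d10.
have nearW : \forall Y \near within M (nbhs W), `|Y - W| < d / K.
  apply: cvg_within; apply/nbhs_ballP; exists (d / K) => // Y.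
  by rewrite -ball_normE /= distrC.
have nearM : \forall Y \near within M (nbhs W), M Y by exact: withinT.
apply: filterS2 nearW nearM => Y Yd MY.
pose V := Y - W; have TV : T0 V := tangent0_sub MW MY.
have -> : Y = W + \sum_k V k.1 k.2 *: tangent_gen k.
  by rewrite -tangent_gen_span// /V addrC subrK.
rewrite [W + _ - W]addrAC subrr add0r -tangent_gen_span//.
rewrite {1}(tangent_gen_span TV).
apply: (le_trans (approx_sum MW H _)).
  apply: (@le_lt_trans _ _ (`|V| * \sum_(k : 'I_m * 'I_n) `|tangent_gen k : mat|)).
    by rewrite mulr_sumr; apply: ler_sum => k _; rewrite ler_wpM2r// le_mx_norm_entry.
  apply: (@le_lt_trans _ _ (`|V| * K)); first by rewrite ler_wpM2l// lerDl.
  by rewrite -ltr_pdivlMr.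
apply: (@le_trans _ _ (e / N * (N * `|V|))); last by rewrite mulrA divfK ?gt_eqF.
rewrite ler_wpM2l ?(ltW e1)//.
apply: (@le_trans _ _ (\sum_(k : 'I_m * 'I_n) `|V|)).
  by apply: ler_sum => k _; exact: le_mx_norm_entry.
by rewrite sumr_const -mulr_natl ler_wpM2r// lerDl.
Qed.

(** The chain rule along the identity map evaluates the total differential at [V]; uniqueness of the
    limit identifies it with [g V W]. Linearity in the direction is thereby derived, not assumed. *)
Lemma derivative_tangent_gen V W : M W -> T0 V ->
  g V W = \sum_k V k.1 k.2 * g (tangent_gen k) W.
Proof.
move=> MW TV.
have idc : {within M, continuous (fun X : mat => X)}.
  by apply/subspace_continuousP => x Ax; exact: cvg_within.
have H : hdw M (f \o (fun X => X)) W V (\sum_k V k.1 k.2 * g (tangent_gen k) W).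
  apply: (has_derivative_within_comp (B := M) (l := V)
    (D := fun V : mat => \sum_k V k.1 k.2 * g (tangent_gen k) W)) => //.
  - exact: has_derivative_within_id.
  - exact: linear_approx_manifold.
  - by move=> a X; rewrite scaler_sumr; apply: eq_bigr => k _; rewrite mxE -mulrA.
  - exact: continuous_lincomb.
have p := dir_nbhs_manifold_proper MW TV.
rewrite -(has_derivative_within_lim p H).
by rewrite -(has_derivative_within_lim p (fg TV MW)).
Qed.

Lemma derivative_manifold_lin a U V W : M W -> T0 U -> T0 V ->
  g (a *: U + V) W = a * g U W + g V W.
Proof.
move=> MW TU TV; rewrite !derivative_tangent_gen//; last exact: tangent0_lin.
rewrite mulr_sumr -big_split/=; apply: eq_bigr => k _.
by rewrite !mxE mulrDl mulrA.
Qed.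

Lemma has_derivative_within_manifold_comp {V0 : normedModType R} (A : set V0)
   (c : V0 -> mat) x v L : A x -> {within A, continuous c} ->
   (forall y, A y -> M (c y)) -> T0 L -> hdw A c x v L ->
   hdw A (f \o c) x v (g L (c x)).
Proof.
move=> Ax cc AM TL cL; rewrite (derivative_tangent_gen (AM _ Ax) TL).
apply: (has_derivative_within_comp (B := M) (l := L)
    (D := fun V : mat => \sum_k V k.1 k.2 * g (tangent_gen k) (c x))) => //.
- by apply: linear_approx_manifold; exact: AM.
- by move=> a X; rewrite scaler_sumr; apply: eq_bigr => k _; rewrite mxE -mulrA.
- exact: continuous_lincomb.
Qed.

End C1.

End Differentiability.

Section MoreRules.
Context {R : realType} {V : normedModType R}.
Implicit Types (A : set V) (x v : V) (f g : V -> R).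
Local Notation hdw := has_derivative_within.

Lemma CkS_derive {U : normedModType R} A (E : set V) k (f : V -> U) v :
  (forall x, A x -> ProperFilter (dir_nbhs A x v)) -> Ck A E k.+1 f -> E v ->
  Ck A E k (derive_within A f v) /\
  forall x, A x -> hdw A f x v (derive_within A f v x).
Proof.
move=> pf [_ /(_ v) H] /H[g fg Cg].
have E1 x : A x -> g x = derive_within A f v x.
  by move=> Ax; have p := pf x Ax; rewrite (has_derivative_within_lim p (fg x Ax)).
by split=> [|x Ax]; [exact: eq_Ck Cg|rewrite -E1//; exact: fg].
Qed.

Lemma has_derivative_withinM A f g x v (k l : R) :
  {within A, continuous g} -> A x -> hdw A f x v k -> hdw A g x v l ->
  hdw A (fun y => f y * g y) x v (k * g x + f x * l).
Proof. exact: has_derivative_withinZ. Qed.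

Lemma has_derivative_within_sum {U : normedModType R} A (I : Type) (s : seq I)
    (h : I -> V -> U) (l : I -> U) x v :
  (forall i, hdw A (h i) x v (l i)) ->
  hdw A (fun y => \sum_(i <- s) h i y) x v (\sum_(i <- s) l i).
Proof.
move=> hl; elim: s => [|i s IH].
  rewrite big_nil (_ : (fun y => _) = cst 0); first exact: has_derivative_within_cst.
  by apply/funext => y; rewrite big_nil.
rewrite big_cons.
rewrite (_ : (fun y => _) = (fun y => h i y + \sum_(j <- s) h j y)); last first.
  by apply/funext => y; rewrite big_cons.
exact: has_derivative_withinD (hl i) IH.
Qed.

End MoreRules.

Section ScalarRules.
Context {R : realType} {V : normedModType R}.
Local Notation hdw := has_derivative_within.

Lemma has_derivative_within_eq_val {U : normedModType R} (A : set V) (f : V -> U) x v l l' :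
  hdw A f x v l -> l = l' -> hdw A f x v l'.
Proof. by move=> ? <-. Qed.

Lemma has_derivative_within_entry {m n : nat} (A : set V) (f : V -> 'M[R]_(m, n)) x v l i j :
  hdw A f x v l -> hdw A (fun y => f y i j) x v (l i j).
Proof.
move=> fl.
have H : (fun h : R => (h^-1 *: (f (x + h *: v) - f x)) i j) @ dir_nbhs A x v --> l i j.
  exact: (cvg_comp _ _ fl (@coord_continuous _ _ _ i j l)).
by apply: near_eq_cvg_to H _; apply: nearW => h; rewrite !mxE.
Qed.

Lemma continuous_within_entry {m n : nat} (A : set V) (f : V -> 'M[R]_(m, n)) i j :
  {within A, continuous f} -> {within A, continuous (fun y => f y i j)}.
Proof.
move=> /subspace_continuousP cf; apply/subspace_continuousP => x Ax.
exact: (cvg_comp _ _ (cf x Ax) (@coord_continuous _ _ _ i j _)).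
Qed.

End ScalarRules.

(** * Derivatives on compact intervals *)

Section Intervals.
Context {R : realType}.
Local Notation hdw := has_derivative_within.

(** Small steps to the right are admissible when [x < b], small steps to the left when [x = b]. *)
Lemma dir_nbhs_itv_proper (a b x : R) : a < b -> `[a, b]%classic x ->
  ProperFilter (dir_nbhs `[a, b] x 1).
Proof.
move=> ab; rewrite /= in_itv/= => /andP[ax xb].
apply: Build_ProperFilter_ex => P.
rewrite /dir_nbhs /within /= => -[e /= e0 H].
have K h : `|h| < e -> h != 0 -> x + h \in `[a, b] -> P h.
  move=> he h0 xh; apply: H => //=; first by rewrite sub0r normrN.
  by rewrite [_ *: _]mulr1.
have [{}xb|xb'] := ltP x b.
  exists (Num.min (e / 2) (b - x)).
  have h0 : 0 < Num.min (e / 2) (b - x) by rewrite lt_min divr_gt0//= subr_gt0.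
  apply: K; rewrite ?gt_eqF//.
    rewrite gtr0_norm// gt_min; apply/orP; left; lra.
  have h1 : Num.min (e / 2) (b - x) <= b - x by rewrite ge_min lexx orbT.
  by rewrite in_itv/=; apply/andP; split; lra.
exists (- Num.min (e / 2) (b - a)).
have h0 : 0 < Num.min (e / 2) (b - a) by rewrite lt_min divr_gt0//= subr_gt0.
apply: K; rewrite ?oppr_eq0 ?gt_eqF//.
  rewrite normrN gtr0_norm// gt_min; apply/orP; left; lra.
have h1 : Num.min (e / 2) (b - a) <= b - a by rewrite ge_min lexx orbT.
by rewrite in_itv/=; apply/andP; split; lra.
Qed.

Lemma dir_nbhs_open (A : set R) (x : R) (P : set R) : (\forall y \near x, A y) ->
  dir_nbhs A x 1 P <-> (0 : R)^' P.
Proof.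
move=> Ax; split; last first.
  by move=> H; exact: (@cvg_within _ (0:R)^' _ [set h | A (x + h *: 1)] P H).
have K0 : (fun h : R => x + h) @ (0 : R) --> x.
  by rewrite -[X in _ --> X]addr0; apply: cvgD; [exact: cvg_cst|exact: cvg_id].
have H : \forall h \near (0 : R)^', A (x + h) by apply: cvg_within; exact: K0 _ Ax.
move=> K; have {}K : \forall h \near (0 : R)^', A (x + h *: 1) -> P h by exact: K.
suff : \forall h \near (0 : R)^', P h by [].
apply: filterS2 K H => h K Mh; apply: K; by rewrite [_ *: _]mulr1.
Qed.

Lemma has_derivative_within_open {U : normedModType R} (A : set R) (f : R -> U) (x : R) l :
  (\forall y \near x, A y) -> hdw A f x 1 l -> is_derive x (1 : R) f l.
Proof.
move=> Ax fl.
have H : (fun h : R => h^-1 *: (f (x + h *: 1) - f x)) @ (0 : R)^' --> l.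
  by move=> P /fl /(dir_nbhs_open _ Ax).
have K : (fun h : R => h^-1 *: (f (h *: 1 + x) - f x)) @ (0 : R)^' --> l.
  by under eq_fun do rewrite [_ + x]addrC.
by apply: DeriveDef; [apply/cvg_ex; exists l|exact: cvg_lim K].
Qed.

Lemma is_derive_has_derivative_within {U : normedModType R} (A : set R) (f : R -> U) (x : R) l :
  is_derive x (1 : R) f l -> hdw A f x 1 l.
Proof.
move=> [/cvg_ex[/= l' fl] Dl].
have ll : l' = l by rewrite -Dl; symmetry; exact: cvg_lim fl.
rewrite -ll /has_derivative_within; apply: cvg_within_filter.
by under eq_fun do rewrite [x + _]addrC.
Qed.

Lemma near_itvoo (a b x : R) : x \in `]a, b[ -> \forall y \near x, `[a, b]%classic y.
Proof.
move=> xab; have : \forall y \near x, y \in `]a, b[ by exact: near_in_itvoo.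
by apply: filterS => y; exact: subset_itv_oo_cc.
Qed.

End Intervals.

Section ProductDomain.
Context {R : realType}.
Variables (A B : set R).

Lemma dir_nbhs_setX1 (s t : R) : B t ->
  dir_nbhs (A `*` B) (s, t) (1, 0) = dir_nbhs A s 1.
Proof.
move=> Bt; rewrite /dir_nbhs (_ : [set h | _] = [set h : R | A (s + h *: 1)])//.
rewrite predeqE => h /=; split=> [[]//|As]; split => //=.
by rewrite scaler0 addr0.
Qed.

Lemma dir_nbhs_setX2 (s t : R) : A s ->
  dir_nbhs (A `*` B) (s, t) (0, 1) = dir_nbhs B t 1.
Proof.
move=> As; rewrite /dir_nbhs (_ : [set h | _] = [set h : R | B (t + h *: 1)])//.
rewrite predeqE => h /=; split=> [[]//|Bt]; split => //=.
by rewrite scaler0 addr0.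
Qed.

Lemma Ck_fst (k : nat) (E : set (R * R)) : Ck (A `*` B) E k (fun p => p.1 : R).
Proof.
have c : {within A `*` B, continuous (fun p : R * R => p.1)}.
  by apply/subspace_continuousP => x Ax; apply: cvg_within_filter; exact: cvg_fst.
case: k => [|k]; split => // v Ev; exists (fun=> v.1); last exact: Ck_cst.
move=> x Ax.
have : (fun h : R => v.1) @ dir_nbhs (A `*` B) x v --> (v.1 : R) by exact: cvg_cst.
move=> /near_eq_cvg_to; apply.
have K := dir_nbhs_neq0 (A `*` B) x v.
apply: filterS K => h h0; rewrite /= addrAC subrr add0r.
by rewrite [_ *: (_ *: _)]scalerA mulVf// scale1r.
Qed.

Lemma Ck_snd (k : nat) (E : set (R * R)) : Ck (A `*` B) E k (fun p => p.2 : R).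
Proof.
have c : {within A `*` B, continuous (fun p : R * R => p.2)}.
  by apply/subspace_continuousP => x Ax; apply: cvg_within_filter; exact: cvg_snd.
case: k => [|k]; split => // v Ev; exists (fun=> v.2); last exact: Ck_cst.
move=> x Ax.
have : (fun h : R => v.2) @ dir_nbhs (A `*` B) x v --> (v.2 : R) by exact: cvg_cst.
move=> /near_eq_cvg_to; apply.
have K := dir_nbhs_neq0 (A `*` B) x v.
apply: filterS K => h h0; rewrite /= addrAC subrr add0r.
by rewrite [_ *: (_ *: _)]scalerA mulVf// scale1r.
Qed.

End ProductDomain.

Section ManifoldCk.
Context {R : realType} {m n : nat}.
Local Notation M := (@assignment_manifold R m n).
Local Notation T0 := (@tangent0 R m n).
Local Notation mat := 'M[R]_(m, n).
Implicit Types (W U V X : mat).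
Local Notation hdw := has_derivative_within.

(** Row sums are continuous and vanish on every difference quotient, hence on the limit. *)
Lemma has_derivative_within_tangent {V0 : normedModType R} (A : set V0) (c : V0 -> mat) x v l :
  ProperFilter (dir_nbhs A x v) -> (forall y, A y -> T0 (c y - c x)) ->
  hdw A c x v l -> T0 l.
Proof.
move=> pf AT cl; apply/tangent0P => i.
have cL : continuous (fun X : mat => \sum_j X i j).
  move=> X; apply: (@cvg_sum R mat (nbhs X) (nbhs_filter X) R) => j.
  exact: coord_continuous.
have H : (fun h : R => \sum_j (h^-1 *: (c (x + h *: v) - c x)) i j) @ dir_nbhs A x v --> \sum_j l i j.
  exact: cvg_comp cl (cL l).
have H0 : (fun h : R => \sum_j (h^-1 *: (c (x + h *: v) - c x)) i j) @ dir_nbhs A x v --> (0 : R).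
  have : (fun=> 0 : R) @ dir_nbhs A x v --> (0 : R) by exact: cvg_cst.
  move=> /near_eq_cvg_to; apply.
  apply: filterS (dir_nbhs_in A x v) => h Ah.
  have /tangent0P/(_ i) := tangent0Z h^-1 (AT _ Ah).
  by move=> ->.
by rewrite -(cvg_lim _ H)// (cvg_lim _ H0).
Qed.

(** The direction [dc x] varies with [x], so the derivative of [f \o c] is expanded over the fixed
    [tangent_gen k]: each coefficient is an entry of [dc], and each remaining factor is a fixed
    function on the manifold composed with [c], to which the induction hypothesis applies. *)
Lemma Ck_comp_manifold {V0 : normedModType R} (A E : set V0) k (f : mat -> R) (c : V0 -> mat) :
  (forall x v, A x -> E v -> ProperFilter (dir_nbhs A x v)) ->
  (forall y, A y -> M (c y)) -> Ck M T0 k f -> Ck A E k c -> Ck A E k (f \o c).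
Proof.
move=> pf AM; elim: k f => [|k IH] f Cf Cc;
  (split; first by exact: continuous_within_comp (Ck_continuous Cc) (Ck_continuous Cf) AM) => // v Ev.
have [dc cdc Cdc] := Cc.2 v Ev.
have dfP V (TV : T0 V) := CkS_derive (fun x Mx => dir_nbhs_manifold_proper Mx TV) Cf TV.
exists (fun x => \sum_k dc x k.1 k.2 * (derive_within M f (tangent_gen k) \o c) x).
  move=> x Ax.
  have TL : T0 (dc x).
    apply: has_derivative_within_tangent (cdc x Ax); first exact: pf.
    by move=> y Ay; apply: tangent0_sub; exact: AM.
  have cg V : T0 V -> {within M, continuous (derive_within M f V)}.
    by move=> TV; have := (dfP V TV).1; exact: Ck_continuous.
  have fg V : T0 V -> forall W, M W -> hdw M f W V (derive_within M f V W).
    by move=> TV W MW; have := (dfP V TV).2 W MW.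
  have := has_derivative_within_manifold_comp (g := derive_within M f) fg cg
     Ax (Ck_continuous Cc) AM TL (cdc x Ax).
  by rewrite (derivative_tangent_gen fg cg (AM _ Ax) TL).
apply: Ck_sum => i _; apply: CkM; first exact: Ck_entry.
apply: IH; last exact: Ck_pred.
exact: (dfP _ (tangent_gen_tangent i)).1.
Qed.

End ManifoldCk.

(** * The conformal factor of the Jacobi metric *)

Section Field.
Context {R : realType} {m n : nat}.
Local Notation M := (@assignment_manifold R m n).
Local Notation T0 := (@tangent0 R m n).
Local Notation mat := 'M[R]_(m, n).
Implicit Types (W U V X : mat) (F : mat -> mat).
Local Notation hdw := has_derivative_within.

Definition jacobi_factor F W : R := 0 - potential F W.

Lemma jacobi_factorE F W : jacobi_factor F W =
  2^-1 * \sum_i (\sum_j W i j * F W i j ^+ 2 - (\sum_j W i j * F W i j) ^+ 2).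
Proof.
rewrite /jacobi_factor /potential sub0r mulNr opprK; congr (_ * _).
apply: eq_bigr => i _; rewrite /Var; congr (_ - _ ^+ 2);
  by apply: eq_bigr => j _; rewrite /rowvec !mxE.
Qed.

Lemma replicatorE W X i j :
  replicator W X i j = W i j * (X i j - \sum_k W i k * X i k).
Proof.
rewrite /replicator /replicator_mx !mxE.
have E k : rowvec W i k 0 = W i k by rewrite /rowvec !mxE.
under eq_bigr => k _.
  rewrite !mxE big_ord1 !mxE mulrBl mulrAC -mulrA.
  over.
rewrite big_split/= sumrN mulrBr; congr (_ - _).
  rewrite (bigD1 j)//= eqxx mulr1n big1 ?addr0//.
  by move=> k kj; rewrite eq_sym (negbTE kj) mulr0n mul0r.
by rewrite mulr_sumr; apply: eq_bigr => k _; ring.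
Qed.

Lemma replicator_tangent W X : M W -> T0 (replicator W X).
Proof.
move=> /assignment_manifoldP[_ W1]; apply/tangent0P => i.
under eq_bigr do rewrite replicatorE mulrBr.
by rewrite big_split/= sumrN -mulr_suml W1 mul1r subrr.
Qed.

(** The replicator operator turns a Euclidean gradient into the Fisher-Rao gradient: the factor
    $W_{ij}$ cancels the weight, and the mean it subtracts is constant along a row, hence orthogonal
    to tangent [V]. *)
Lemma fisher_rao_replicator W X V : M W -> T0 V ->
  fisher_rao W (replicator W X) V = \sum_i \sum_j X i j * V i j.
Proof.
move=> [W0 _] /tangent0P TV; apply: eq_bigr => i _.
transitivity (\sum_j (X i j * V i j - (\sum_k W i k * X i k) * V i j)).
  by apply: eq_bigr => j _; rewrite replicatorE; field; rewrite gt_eqF.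
by rewrite big_split/= sumrN -mulr_sumr TV mulr0 subr0.
Qed.

Lemma jacobi_factor_fisher_rao F W : M W ->
  jacobi_factor F W =
  2^-1 * fisher_rao W (replicator W (F W)) (replicator W (F W)).
Proof.
move=> MW; rewrite fisher_rao_replicator//; last exact: replicator_tangent.
rewrite jacobi_factorE; congr (_ * _); apply: eq_bigr => i _.
rewrite expr2 mulr_suml -sumrB; apply: eq_bigr => j _.
by rewrite replicatorE; ring.
Qed.

Lemma smooth_field_Ck F k : smooth_field F -> Ck M T0 k F.
Proof.
move=> sF; have [+ _] := smooth_onP F (@dir_nbhs_manifold_proper R m n).
by move=> /(_ sF).
Qed.

Lemma Ck_jacobi_factor F k : smooth_field F -> Ck M T0 k (jacobi_factor F).
Proof.
move=> sF; have CF i j := Ck_entry i j (smooth_field_Ck k sF).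
have CW i j : Ck M T0 k (fun W => W i j) by apply: Ck_entry; exact: Ck_id.
apply: (@eq_Ck _ _ _ _ _ _ (fun W => 2^-1 *
  \sum_i (\sum_j W i j * F W i j ^+ 2 - (\sum_j W i j * F W i j) ^+ 2))).
  by move=> W _; rewrite jacobi_factorE.
apply: CkM; first exact: Ck_cst.
apply: Ck_sum => i _; apply: CkD.
  by apply: Ck_sum => j _; apply: CkM => //; exact: CkM.
apply: CkN; rewrite (_ : (fun x => _) =
  (fun W => (\sum_j W i j * F W i j) * (\sum_j W i j * F W i j))); last first.
  by apply/funext => W; rewrite expr2.
by apply: CkM; apply: Ck_sum => j _; exact: CkM.
Qed.

Lemma Ck_replicator F k i j : smooth_field F ->
  Ck M T0 k (fun W => replicator W (F W) i j).
Proof.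
move=> sF; have CF i' j' := Ck_entry i' j' (smooth_field_Ck k sF).
have CW i' j' : Ck M T0 k (fun W => W i' j') by apply: Ck_entry; exact: Ck_id.
apply: (@eq_Ck _ _ _ _ _ _ (fun W => W i j * (F W i j - \sum_k W i k * F W i k))).
  by move=> W _; rewrite replicatorE.
apply: CkM => //; apply: CkD => //; apply: CkN.
by apply: Ck_sum => l _; exact: CkM.
Qed.

End Field.

(** * Bounds on compact sets and Gronwall's lemma *)

Section Bounds.
Context {R : realType}.
Local Notation hdw := has_derivative_within.

Lemma bounded_on_compact {T : topologicalType} (A : set T) (f : T -> R) :
  compact A -> {within A, continuous f} ->
  exists2 C : R, 0 < C & forall x, A x -> `|f x| <= C.
Proof.
move=> cA cf; have /compact_bounded := continuous_compact cf cA.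
move=> /pinfty_ex_gt0[C C0 H]; exists C => // x Ax.
by apply: H; exists x.
Qed.

Lemma bounded_on_compact_finite {T : topologicalType} {I : finType} (A : set T)
    (f : I -> T -> R) :
  compact A -> (forall i, {within A, continuous (f i)}) ->
  exists2 C : R, 0 < C & forall x, A x -> forall i, `|f i x| <= C.
Proof.
move=> cA cf.
have [C HC] : {C : I -> R & forall i, 0 < C i /\ forall x, A x -> `|f i x| <= C i}.
  apply: (@choice _ _ (fun i (C : R) => 0 < C /\ forall x, A x -> `|f i x| <= C)) => i.
  by have [C C0 H] := bounded_on_compact cA (cf i); exists C.
exists (1 + \sum_i C i).
  by rewrite ltr_pwDl// sumr_ge0// => i _; have [/ltW] := HC i.
move=> x Ax i; have [_ /(_ x Ax) H] := HC i.
apply: (le_trans H); rewrite ler_wpDl// (bigD1 i)//= lerDl sumr_ge0// => j _.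
by have [/ltW] := HC j.
Qed.

(* q exp(K t) is nondecreasing and q exp(- K t) is nonincreasing. *)
Lemma gronwall_pos (a b K : R) (q dq : R -> R) (s t : R) : a < b ->
  {within `[a, b], continuous q} ->
  (forall x, x \in `[a, b] -> hdw `[a, b] q x 1 (dq x)) ->
  (forall x, x \in `[a, b] -> `|dq x| <= K * q x) ->
  s \in `[a, b] -> t \in `[a, b] -> 0 < q s -> 0 < q t.
Proof.
move=> ab cq hq dqK; rewrite !in_itv/= => /andP[as_ sb] /andP[at_ tb] qs.
have key (c : R) x : x \in `]a, b[ ->
    is_derive x (1 : R) (fun y => q y * expR (c * y)) ((dq x + c * q x) * expR (c * x)).
  move=> xab.
  have h1 : is_derive x (1 : R) q (dq x).
    by apply: has_derivative_within_open (near_itvoo xab) (hq _ _); exact: subset_itv_oo_cc.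
  have h2 : is_derive x (1 : R) (fun y => expR (c * y)) (c * expR (c * x)).
    apply: is_derive_eq; rewrite /GRing.scale/=; ring.
  apply: is_derive_eq; rewrite /GRing.scale/=; ring.
have cont (c : R) : {within `[a, b], continuous (fun y => q y * expR (c * y))}.
  apply: (continuous_withinZ (U := R)) => //.
  apply: continuous_subspaceT => y.
  apply: continuous_comp; last exact: continuous_expR.
  by apply: cvgM; [exact: cvg_cst|exact: cvg_id].
have sgn x : x \in `]a, b[ -> 0 <= dq x + K * q x /\ dq x - K * q x <= 0.
  move=> /subset_itv_oo_cc /dqK; rewrite ler_norml => /andP[h1 h2]; split; lra.
have [st|/ltW ts] := leP s t.
  have := @ger0_derive1_ndecr R (fun y => q y * expR (K * y)) a b _ _ (cont K) s t as_ st tb.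
  have -> : 0 < q t = (0 < q t * expR (K * t)) by rewrite pmulr_lgt0// expR_gt0.
  move=> H; apply: lt_le_trans (H _ _).
  - by rewrite mulr_gt0// expR_gt0.
  - by move=> x /(key K)[].
  - move=> x xab; have [_ ] := key K x xab; rewrite derive1E => ->.
    by rewrite mulr_ge0 ?expR_ge0//; exact: (sgn x xab).1.
have := @ler0_derive1_nincr R (fun y => q y * expR (- K * y)) a b _ _ (cont (- K)) t s at_ ts sb.
have -> : 0 < q t = (0 < q t * expR (- K * t)) by rewrite pmulr_lgt0// expR_gt0.
move=> H; apply: lt_le_trans (H _ _).
- by rewrite mulr_gt0// expR_gt0.
- by move=> x /(key (- K))[].
- move=> x xab; have [_ ] := key (- K) x xab; rewrite derive1E => ->.
  by rewrite mulr_le0_ge0 ?expR_ge0// mulNr; exact: (sgn x xab).2.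
Qed.

End Bounds.

(** * Persistence of positive speed along the flow *)

Section Speed.
Context {R : realType} {m n : nat}.
Local Notation M := (@assignment_manifold R m n).
Local Notation T0 := (@tangent0 R m n).
Local Notation mat := 'M[R]_(m, n).
Local Notation hdw := has_derivative_within.
Variables (F : mat -> mat) (t0 t1 : R) (W : R -> mat).
Hypothesis sF : smooth_field F.
Hypothesis t01 : t0 < t1.
Hypothesis hW : integral_curve F t0 t1 W.
Hypothesis sW : smooth_curve t0 t1 W.

Lemma smooth_curve_Ck {U : normedModType R} (c : R -> U) :
  smooth_curve t0 t1 c <-> forall k, Ck `[t0, t1] [set 1] k c.
Proof. by apply: smooth_onP => x v Ix ->; exact: dir_nbhs_itv_proper. Qed.

Lemma jacobi_factor_gt0 s t : s \in `[t0, t1] -> t \in `[t0, t1] ->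
  0 < jacobi_factor F (W s) -> 0 < jacobi_factor F (W t).
Proof.
move=> sI tI rs.
have MW x : x \in `[t0, t1] -> M (W x) by move=> /hW[].
pose X ij V := replicator V (F V) ij.1 ij.2 : R.
pose dX ij k := derive_within M (X ij) (tangent_gen k).
have CX ij : Ck M T0 1 (X ij) by exact: Ck_replicator.
have dXP ij V (TV : T0 V) := CkS_derive (fun x Mx => dir_nbhs_manifold_proper Mx TV) (CX ij) TV.
have cW : {within `[t0, t1], continuous W}.
  by have /smooth_curve_Ck/(_ 0%N)[] := sW.
have cXW ij : {within `[t0, t1], continuous (X ij \o W)}.
  by apply: continuous_within_comp (Ck_continuous (CX ij)) _ => // x; exact: MW.
have cdXW ij k : {within `[t0, t1], continuous (dX ij k \o W)}.
  apply: continuous_within_comp (cW) (Ck_continuous (dXP ij _ (tangent_gen_tangent k)).1) _.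
  by move=> x; exact: MW.
pose v ij := X ij \o W.
have dv ij x : x \in `[t0, t1] -> hdw `[t0, t1] (v ij) x 1 (\sum_k v k x * dX ij k (W x)).
  move=> xI; have [MWx dW vW] := hW xI.
  have fg V : T0 V -> forall W0, M W0 -> hdw M (X ij) W0 V (derive_within M (X ij) V W0).
    by move=> TV W0 MW0; have := (dXP ij V TV).2 W0 MW0.
  have cg V : T0 V -> {within M, continuous (derive_within M (X ij) V)}.
    by move=> TV; have := (dXP ij V TV).1; exact: Ck_continuous.
  have TX : T0 (replicator (W x) (F (W x))) by exact: replicator_tangent.
  have hv : hdw `[t0, t1] W x 1 (replicator (W x) (F (W x))).
    by rewrite -vW; exact: derivable_withinP.
  have := has_derivative_within_manifold_comp fg cg xI cW MW TX hv.
  by rewrite (derivative_tangent_gen fg cg MWx TX).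
(* The Euclidean speed replaces the Fisher-Rao one: its derivative contains no derivative of the
   weights $1/W_{ij}$. As these weights are positive, both speeds vanish at the same times, which is
   [qr]. *)
pose q x := \sum_ij v ij x ^+ 2.
pose dq x := \sum_ij 2 * (v ij x * \sum_k v k x * dX ij k (W x)).
have hq x : x \in `[t0, t1] -> hdw `[t0, t1] q x 1 (dq x).
  move=> xI; apply: has_derivative_within_sum => ij.
  have := has_derivative_withinM (cXW ij) xI (dv ij x xI) (dv ij x xI).
  rewrite (_ : _ + _ = 2 * (v ij x * \sum_k v k x * dX ij k (W x))); last by rewrite /v/=; ring.
  by rewrite (_ : (fun y => _) = (fun y => v ij y ^+ 2))//; apply/funext => y; rewrite expr2.
have cq : {within `[t0, t1], continuous q}.
  apply/subspace_continuousP => x xI; apply: (cvg_sum (U := R)) => ij.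
  rewrite /=; under eq_fun do rewrite expr2; rewrite expr2.
  by have /subspace_continuousP/(_ x xI) H := cXW ij; apply: cvgM.
have [C C0 HC] : exists2 C : R, 0 < C &
    forall x : R, x \in `[t0, t1] -> forall ij k, `|dX ij k (W x)| <= C.
  have [C C0 HC] := bounded_on_compact_finite
    (f := fun p : ('I_m * 'I_n) * ('I_m * 'I_n) => dX p.1 p.2 \o W)
    (@segment_compact _ t0 t1) (fun p => cdXW p.1 p.2).
  by exists C => // x xI ij k; exact: (HC x xI (ij, k)).
pose N := #|{: 'I_m * 'I_n}|%:R : R.
(* Each product satisfies $2|v_{ij}v_k| \le v_{ij}^2+v_k^2$; summed over both indices, the
   right-hand side is $2Nq$. *)
have dqq x : x \in `[t0, t1] -> `|dq x| <= 2 * C * N * q x.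
  move=> xI; apply: (le_trans (ler_norm_sum _ _ _)).
  apply: (@le_trans _ _ (\sum_ij \sum_k C * (v ij x ^+ 2 + v k x ^+ 2))).
    apply: ler_sum => ij _; rewrite mulr_sumr mulr_sumr.
    apply: (le_trans (ler_norm_sum _ _ _)); apply: ler_sum => k _.
    have B := HC x xI ij k.
    rewrite mulrA mulrA normrM mulrC; apply: ler_pM => //.
    rewrite -mulrA normrM ger0_norm// -subr_ge0.
    have : 0 <= (v ij x - v k x) ^+ 2 /\ 0 <= (v ij x + v k x) ^+ 2 by rewrite !sqr_ge0.
    move=> [h1 h2]; rewrite subr_ge0.
    have : `|v ij x * v k x| <= (v ij x ^+ 2 + v k x ^+ 2) / 2.
      by rewrite ler_norml; apply/andP; split; lra.
    by move=> h3; lra.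
  have -> : \sum_ij \sum_k C * (v ij x ^+ 2 + v k x ^+ 2) = \sum_ij C * (N * v ij x ^+ 2 + q x).
    apply: eq_bigr => ij _; rewrite -mulr_sumr big_split/=; congr (_ * (_ + _)).
    by rewrite sumr_const mulr_natl.
  rewrite -mulr_sumr big_split/= -mulr_sumr sumr_const -/(q x).
  have -> : q x *+ #|xpredT : pred ('I_m * 'I_n)| = N * q x by rewrite mulr_natl.
  by rewrite [leLHS](_ : _ = 2 * C * N * q x)//; ring.
have qr x : x \in `[t0, t1] -> (0 < q x) = (0 < jacobi_factor F (W x)).
  move=> xI; have MWx := MW x xI; have [W0 _] := MWx.
  rewrite jacobi_factor_fisher_rao// pmulr_rgt0 ?invr_gt0//.
  have q0 : 0 <= q x by apply: sumr_ge0 => ij _; exact: sqr_ge0.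
  have fE : fisher_rao (W x) (replicator (W x) (F (W x))) (replicator (W x) (F (W x))) =
    \sum_ij v ij x ^+ 2 / W x ij.1 ij.2.
    by rewrite /fisher_rao pair_big/=; apply: eq_bigr => ij _; rewrite expr2.
  have r0 : 0 <= \sum_ij v ij x ^+ 2 / W x ij.1 ij.2.
    by apply: sumr_ge0 => ij _; rewrite divr_ge0 ?sqr_ge0// ltW.
  rewrite fE !lt_def q0 r0 !andbT; congr (~~ _).
  rewrite !psumr_eq0; last 2 first.
  - by move=> ij _; rewrite divr_ge0 ?sqr_ge0// ltW.
  - by move=> ij _; exact: sqr_ge0.
  apply: eq_all => ij /=.
  by rewrite [in RHS]mulf_eq0 invr_eq0 [W x _ _ == 0]gt_eqF ?orbF.
rewrite -(qr t tI); apply: (gronwall_pos t01 cq hq dqq sI tI).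
by rewrite qr.
Qed.

End Speed.

(** * The Euler-Lagrange equation *)

Section IntegralLemmas.
Context {R : realType}.
Local Notation hdw := has_derivative_within.
Local Notation mu := (@lebesgue_measure R).
Implicit Types (a b : R) (f : R -> R).

Lemma dir_nbhs_itv_neq a b x z :
  \forall h \near dir_nbhs `[a, b] x 1, x + h *: (1 : R) != z :> R.
Proof.
have [<-|xz] := eqVneq x z.
  apply: filterS (dir_nbhs_neq0 _ _ _) => h h0.
  by rewrite [_ *: _]mulr1 addrC -subr_eq0 addrK.
have := cvg_dir_nbhs `[a, b] x (1 : R).
have zx : 0 < `|z - x| by rewrite normr_gt0 subr_eq0 eq_sym.
move=> /cvgr0_norm_lt /(_ _ zx); apply: filterS => h.
rewrite [_ *: _]mulr1; apply: contraTneq => <-.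
by rewrite addrAC subrr add0r ltxx.
Qed.

(** The values at the endpoints are limits along interior points. *)
Lemma eq0_itv_closed a b f : a < b -> {within `[a, b], continuous f} ->
  (forall x, x \in `]a, b[ -> f x = 0) -> forall x, x \in `[a, b] -> f x = 0.
Proof.
move=> ab cf f0 x xab.
have pf := dir_nbhs_itv_proper ab xab.
have H := continuous_within_dir (1 : R) cf xab.
have H0 : (fun h : R => f (x + h *: 1)) @ dir_nbhs `[a, b] x 1 --> (0 : R).
  have : (fun=> 0 : R) @ dir_nbhs `[a, b] x 1 --> (0 : R) by exact: cvg_cst.
  move=> /near_eq_cvg_to; apply.
  apply: filterS3 (dir_nbhs_in _ _ _) (dir_nbhs_itv_neq a b x a) (dir_nbhs_itv_neq a b x b) => h.
  rewrite /= in_itv/= => /andP[h1 h2] ha hb; rewrite f0// in_itv/=.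
  by rewrite !lt_neqAle h1 h2 hb eq_sym ha.
by rewrite -(cvg_lim _ H)// (cvg_lim _ H0).
Qed.

Lemma continuous_itv_integrable a b f : {within `[a, b], continuous f} ->
  mu.-integrable `[a, b] (EFin \o f).
Proof. by move=> cf; apply: continuous_compact_integrable => //; exact: segment_compact. Qed.

Lemma Rintegral_derivative_within a b f df : a < b ->
  {within `[a, b], continuous f} -> {within `[a, b], continuous df} ->
  (forall x, x \in `[a, b] -> hdw `[a, b] f x 1 (df x)) ->
  \int[mu]_(x in `[a, b]) df x = f b - f a.
Proof.
move=> ab cf cdf fdf.
have D x : x \in `]a, b[ -> is_derive x (1 : R) f (df x).
  by move=> xab; apply: has_derivative_within_open (near_itvoo xab) (fdf _ _); exact: subset_itv_oo_cc.
have H : derivable_oo_LRcontinuous f a b.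
  have [_ fa fb] := (continuous_within_itvP f ab).1 cf.
  by split => // x /D[].
rewrite /Rintegral (continuous_FTC2 ab cdf H)// => x /D[_ <-].
by rewrite derive1E.
Qed.

(** The primitive of [f] is nondecreasing and takes the value 0 at both ends, so it is identically
    0, and so is its derivative [f] in the interior. *)
Lemma Rintegral_eq0 a b f : a < b -> {within `[a, b], continuous f} ->
  (forall x, x \in `[a, b] -> 0 <= f x) ->
  \int[mu]_(x in `[a, b]) f x = 0 -> forall x, x \in `[a, b] -> f x = 0.
Proof.
move=> ab cf f0 intf0; apply: eq0_itv_closed => // x xab.
have intf := continuous_itv_integrable cf.
pose P y := \int[mu]_(t in `[a, y]) f t.
have cP : {within `[a, b], continuous P}.
  exact: parameterized_integral_continuous (ltW ab) intf.
have [cof _ _] := (continuous_within_itvP f ab).1 cf.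
have dP y : y \in `]a, b[ -> derivable P y 1 /\ P^`()%classic y = f y.
  move=> yab; have := yab; rewrite in_itv/= => /andP[ay yb].
  by apply: (continuous_FTC1_closed yb intf ay); exact: cof.
have Pa : P a = 0 by rewrite /P set_itv1 Rintegral_set1.
have mono := @ger0_derive1_ndecr _ P a b (fun y yab => (dP y yab).1) _ cP.
have {}mono y z : a <= y -> y <= z -> z <= b -> P y <= P z.
  apply: mono => t tab; rewrite (dP t tab).2.
  by apply: f0; exact: subset_itv_oo_cc.
have P0 y : y \in `[a, b] -> P y = 0.
  rewrite in_itv/= => /andP[ay yb]; apply/eqP; rewrite eq_le.
  by rewrite -{1}intf0 -{1}Pa !mono.
have [_ <-] := dP x xab.
rewrite derive1E.
have /near_eq_derive -> : \forall y \near x, P y = cst 0 y.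
  by apply: filterS (near_itvoo xab) => y; exact: P0.
exact: derive_cst.
Qed.

End IntegralLemmas.

(** * First variation of the action *)

Section Variation.
Context {R : realType} {m n : nat}.
Local Notation M := (@assignment_manifold R m n).
Local Notation T0 := (@tangent0 R m n).
Local Notation mat := 'M[R]_(m, n).
Local Notation hdw := has_derivative_within.
Local Notation mu := (@lebesgue_measure R).
Variables (F : mat -> mat) (t0 t1 : R) (W : R -> mat).
Hypothesis sF : smooth_field F.
Hypothesis t01 : t0 < t1.
Hypothesis hcrit : critical_point (action_functional F t0 t1) t0 t1 W.
Local Notation I := (`[t0, t1]%classic : set R).
Local Notation v := (velocity t0 t1 W).
Local Notation rho := (jacobi_factor F).

Lemma Ck_velocity {U : normedModType R} (c : R -> U) : (forall k, Ck I [set 1] k c) ->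
  (forall k, Ck I [set 1] k (velocity t0 t1 c)) /\
  forall t, I t -> hdw I c t 1 (velocity t0 t1 c t).
Proof.
move=> Cc.
have pf x : I x -> ProperFilter (dir_nbhs I x (1 : R)) by exact: dir_nbhs_itv_proper.
have H k := CkS_derive pf (Cc k.+1) (erefl : [set 1] (1 : R)).
by split=> [k|t It]; [exact: (H k).1|exact: (H 0%N).2].
Qed.

Lemma velocityP {U : normedModType R} (c : R -> U) t l : I t ->
  hdw I c t 1 l -> velocity t0 t1 c t = l.
Proof.
by move=> It; have p := dir_nbhs_itv_proper t01 It; exact: has_derivative_within_lim.
Qed.

Let CW k : Ck I [set 1] k W.
Proof. by have [/(smooth_curve_Ck t01)] := hcrit. Qed.

Let MW t : I t -> M (W t).
Proof. by have [_ + _] := hcrit; apply. Qed.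

Let Cv k : Ck I [set 1] k v := (Ck_velocity CW).1 k.

Let dW t : I t -> hdw I W t 1 (v t) := (Ck_velocity CW).2 t.

(** The derivative at $s=0$ of the Lagrangian along $W+s\eta V$, with [deta] standing for
    $\dot\eta$. The first summand varies the velocity, the second the weights $1/W_{ij}$ of the
    metric, the last term $\rho$. *)
Definition variation_integrand (eta deta : R -> R) (V : mat) t : R :=
  \sum_i \sum_j (v t i j * (deta t * V i j) / W t i j
     - 2^-1 * v t i j ^+ 2 * (eta t * V i j) / W t i j ^+ 2)
  + eta t * derive_within M rho V (W t).

(** The quotients $\eta V_{ij}/W_{ij}$ are bounded by some [C] on the compact interval, so $|s| <
    1/C$ keeps each entry of the perturbation below that of [W]. *)
Lemma variation_radius (eta : R -> R) (V : mat) : {within I, continuous eta} -> T0 V ->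
  exists2 e : R, 0 < e & forall s t, `|s| < e -> I t -> M (W t + s *: (eta t *: V)).
Proof.
move=> ceta TV.
have cW : {within I, continuous W} by exact: Ck_continuous (CW 0).
have W0 t ij : I t -> 0 < W t ij.1 ij.2 by move=> /MW[+ _]; apply.
have cf (ij : 'I_m * 'I_n) :
    {within I, continuous (fun t => eta t * V ij.1 ij.2 * (W t ij.1 ij.2)^-1)}.
  apply: (continuous_withinZ (U := R)).
    apply: (continuous_withinZ (U := R)) => //.
    by apply/subspace_continuousP => x _; exact: cvg_cst.
  apply: continuous_withinV; last exact: continuous_within_entry.
  by move=> t It; rewrite gt_eqF// W0.
have [C C0 HC] := bounded_on_compact_finite (@segment_compact _ t0 t1) cf.
exists C^-1; first by rewrite invr_gt0.
move=> s t sC It; have [_ W1] := MW It; split; last first.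
  by rewrite mulmxDl W1 -!scalemxAl TV !scaler0 addr0.
move=> i j; have Wij := W0 t (i, j) It; rewrite /= in Wij.
have B := HC t It (i, j); rewrite /= in B.
rewrite !mxE.
have : `|s * (eta t * V i j)| < W t i j.
  have -> : s * (eta t * V i j) = s * (eta t * V i j * (W t i j)^-1) * W t i j.
    by field; rewrite gt_eqF.
  rewrite normrM (gtr0_norm Wij) -[ltRHS]mul1r ltr_pM2r// normrM.
  apply: (@le_lt_trans _ _ (`|s| * C)); first by rewrite ler_wpM2l.
  by rewrite -(mulVf (x := C)) ?gt_eqF// ltr_pM2r.
by rewrite ltr_norml => /andP[H _]; rewrite -ltrBlDl sub0r.
Qed.

(** Criticality makes the derivative of the action at $s=0$ vanish; differentiation under the
    integral sign moves this derivative onto the Lagrangian. *)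
Lemma integral_variation (eta deta : R -> R) (V : mat) : T0 V ->
  (forall k, Ck I [set 1] k eta) -> (forall k, Ck I [set 1] k deta) ->
  (forall t, I t -> hdw I eta t 1 (deta t)) ->
  eta t0 = 0 -> eta t1 = 0 ->
  \int[mu]_(t in I) variation_integrand eta deta V t = 0.
Proof.
move=> TV Ceta Cdeta deta_ eta0 eta1.
have [e e0 eM] := variation_radius (Ck_continuous (Ceta 0%N)) TV.
pose S := (`]- e, e[%classic : set R).
pose A := S `*` I.
pose E := [set ((1, 0) : R * R); (0, 1)].
have Sabs s : S s -> `|s| < e by rewrite /S/= in_itv/= ltr_norml.
have pfA x w : A x -> E w -> ProperFilter (dir_nbhs A x w).
  move: x => [s t] [/= Ss It] [->|->].
    rewrite dir_nbhs_setX1//; apply: Build_ProperFilter_ex => P.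
    move=> /dir_nbhs_open H; apply: filter_ex (H _).
    by apply: near_in_itvoo.
  by rewrite dir_nbhs_setX2//; exact: dir_nbhs_itv_proper.
pose H (p : R * R) : mat := W p.2 + p.1 *: (eta p.2 *: V).
(* The velocity of [H] in $t$, in closed form, so that smoothness of the Lagrangian [Phi] in both
   variables follows from the closure rules; [actE] checks that it is the velocity. *)
pose N (p : R * R) : mat := v p.2 + p.1 *: (deta p.2 *: V).
have A2 p : A p -> I p.2 by move=> [].
have Csnd (U : normedModType R) k (c : R -> U) : Ck I [set 1] k c -> Ck A E k (fun p => c p.2).
  by move=> Cc; apply: (Ck_comp_curve A2 (Ck_snd _ _ _ _) Cc).
have Clin k (c : R -> mat) (h : R -> R) : Ck I [set 1] k c -> Ck I [set 1] k h ->
  Ck A E k (fun p => c p.2 + p.1 *: (h p.2 *: V)).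
  move=> Cc Ch; apply: CkD; first exact: Csnd.
  apply: CkZ; first exact: Ck_fst.
  by apply: CkZ; [exact: Csnd|exact: Ck_cst].
have CH k : Ck A E k H by exact: Clin.
have CN k : Ck A E k N by exact: Clin.
have HM p : A p -> M (H p).
  by move: p => [s t] [/= /Sabs se It]; exact: eM.
pose Phi p := 2^-1 * fisher_rao (H p) (N p) (N p) + rho (H p).
have CPhi k : Ck A E k Phi.
  apply: CkD; last exact: Ck_comp_manifold (Ck_jacobi_factor k sF) (CH k).
  apply: CkM; first exact: Ck_cst.
  apply: Ck_sum => i _; apply: Ck_sum => j _; apply: CkM.
    by apply: CkM; exact: Ck_entry.
  apply: CkV; last exact: Ck_entry.
  by move=> p /HM[/(_ i j) H0 _]; rewrite gt_eqF.
have E1 : E (1, 0) by left.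
have [CdPhi dPhiP] : (forall k, Ck A E k (derive_within A Phi (1, 0))) /\
    forall p, A p -> hdw A Phi p (1, 0) (derive_within A Phi (1, 0) p).
  have K k := CkS_derive (fun x Ax => pfA x _ Ax E1) (CPhi k.+1) E1.
  by split=> [k|p Ap]; [exact: (K k).1|exact: (K 0%N).2].
set dPhi := derive_within A Phi (1, 0) in CdPhi dPhiP.
have var : fixed_endpoint_variation t0 t1 W e H.
  split.
  - by apply/(smooth_onP H pfA) => k; exact: CH.
  - by move=> s t Ss It; apply: HM; split.
  - by move=> t _; rewrite /H /= scale0r addr0.
  - by move=> s _; rewrite /H /= eta0 eta1 !scale0r !scaler0 !addr0.
have actE s : S s -> action_functional F t0 t1 (fun t => H (s, t)) = \int[mu]_(t in I) Phi (s, t).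
  move=> Ss; apply: eq_Rintegral => t; rewrite inE => It.
  have -> : velocity t0 t1 (fun t => H (s, t)) t = N (s, t).
    apply: velocityP => //.
    apply: has_derivative_withinD; first exact: dW.
    have Ks : {within I, continuous (fun t : R => s)}.
      by apply/subspace_continuousP => x _; exact: cvg_cst.
    have KV : {within I, continuous (fun t : R => V)}.
      by apply/subspace_continuousP => x _; exact: cvg_cst.
    have h1 : hdw I (fun t => eta t *: V) t 1 (deta t *: V).
      apply: has_derivative_within_eq_val (has_derivative_withinZ KV It (deta_ t It)
        (has_derivative_within_cst _ _ _ _)) _.
      by rewrite scaler0 addr0.
    have cV : {within I, continuous (fun t => eta t *: V)}.
      by apply: continuous_withinZ => //; exact: Ck_continuous (Ceta 0%N).
    apply: has_derivative_within_eq_val (has_derivative_withinZ cV It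
      (has_derivative_within_cst _ _ _ _) h1) _.
    by rewrite scale0r add0r.
  rewrite /Phi; congr (_ + _).
  by rewrite /jacobi_factor /potential sub0r mulNr opprK.
have contPhi (f : R * R -> R) s : S s -> {within A, continuous f} ->
    {within I, continuous (fun t => f (s, t))}.
  move=> Ss cf; apply: (continuous_within_comp (g := fun t : R => (s, t)) _ cf) => //.
  apply/subspace_continuousP => t It; apply: cvg_within_filter.
  exact: (cvg_pair (@cvg_cst _ s _ _ _) (@cvg_id _ (nbhs t))).
have S0 : S 0 by rewrite /S/= in_itv/= oppr_lt0 e0.
have dPhi1 s t : S s -> I t -> is_derive s (1 : R) (fun s => Phi (s, t)) (dPhi (s, t)).
  move=> Ss It; apply: (has_derivative_within_open (A := S)); first exact: near_in_itvoo.
  have := dPhiP (s, t) (conj Ss It).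
  rewrite /has_derivative_within dir_nbhs_setX1//.
  have -> // : (fun h : R => h^-1 *: (Phi ((s, t) + h *: (1, 0)) - Phi (s, t))) =
    (fun h : R => h^-1 *: (Phi (s + h *: 1, t) - Phi (s, t))).
  by apply/funext => h; congr (_ *: (Phi _ - _)); congr pair; rewrite /= scaler0 addr0.
have intdPhi : \int[mu]_(t in I) dPhi (0, t) = 0.
  (* Halving the radius leaves a compact rectangle inside the domain, on which the continuous [dPhi]
     is bounded by a constant [C]; this constant is the dominating function. *)
  pose u := e / 2.
  have uS s : `]- u, u[%classic s -> S s.
    rewrite /S /u /= !in_itv/= => /andP[h1 h2]; apply/andP; split; lra.
  have K : compact (`[- u, u]%classic `*` I).
    by apply: compact_setX; exact: segment_compact.
  have cK : {within `[- u, u]%classic `*` I, continuous dPhi}.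
    apply: continuous_subspaceW (Ck_continuous (CdPhi 0%N)) => -[s t] [/= su It]; split => //=.
    move: su; rewrite /S /u /= !in_itv/= => /andP[h1 h2]; apply/andP; split; lra.
  have [C C0 HC] := bounded_on_compact K cK.
  have u0 : `]- u, u[%classic (0 : R).
    by rewrite /= in_itv/= oppr_lt0 /u divr_gt0.
  have mI := @measurable_itv R `[t0, t1].
  have partE s t : S s -> I t -> partial1of2 (fun s t => Phi (s, t)) s t = dPhi (s, t).
    by move=> Ss It; rewrite partial1of2E; have [_ ->] := dPhi1 s t Ss It.
  have i1 (x : R) : `]- u, u[%classic x -> mu.-integrable I (EFin \o (fun t => Phi (x, t))).
    move=> /uS Sx; apply: continuous_itv_integrable; apply: contPhi => //.
    exact: Ck_continuous (CPhi 0%N).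
  have i2 (x y : R) : `]- u, u[%classic x -> I y -> derivable (fun s => Phi (s, y)) x 1.
    by move=> /uS Sx Iy; have [] := dPhi1 x y Sx Iy.
  have i3 : mu.-integrable I (EFin \o (fun=> C)).
    apply: continuous_itv_integrable.
    by apply/subspace_continuousP => x _; exact: cvg_cst.
  have i4 (x y : R) : `]- u, u[%classic x -> I y ->
      `|partial1of2 (fun s t => Phi (s, t)) x y| <= C.
    move=> xu Iy; rewrite partE//; last exact: uS.
    by apply: HC; split => //=; exact: subset_itv_oo_cc.
  have D1 := @differentiation_under_integral R _ _ mu (fun s t => Phi (s, t))
    I mI 0 (- u) u u0 i1 i2 (fun=> C) (fun=> ltW C0) i3 i4.
  have D2 : is_derive (0 : R) (1 : R) (fun s : R => \int[mu]_(t in I) Phi (s, t)) (0 : R).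
    have [_ _ /(_ e H e0 var)] := hcrit.
    apply: near_eq_is_derive.
    have : \forall s \near (0 : R), s \in `]- e, e[ by exact: near_in_itvoo.
    by apply: filterS => s Ss; exact: actE.
  have [_ D3] := D2.
  move: D1; rewrite derive1E D3 => D1; rewrite [RHS]D1; apply: eq_Rintegral => t; rewrite inE => It.
  by rewrite partE.
(* What remains is pointwise: the partial derivative of [Phi] at $s=0$ is computed by the rules and
   matched with the integrand by uniqueness of the limit. *)
rewrite -[RHS]intdPhi; apply: eq_Rintegral => t; rewrite inE => It.
have A0 : A (0, t) by split.
have pf0 := pfA _ _ A0 E1.
symmetry; apply: (has_derivative_within_lim pf0).
have cst_snd (U : normedModType R) (c : R -> U) : hdw A (fun p => c p.2) (0, t) (1, 0) 0.
  have : (fun=> 0 : U) @ dir_nbhs A (0, t) (1, 0) --> (0 : U) by exact: cvg_cst.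
  move=> /near_eq_cvg_to; apply; apply: nearW => h /=.
  by rewrite scaler0 addr0 subrr scaler0.
have dfst : hdw A (fun p : R * R => p.1) (0, t) (1, 0) (1 : R).
  have : (fun=> 1 : R) @ dir_nbhs A (0, t) (1, 0) --> (1 : R) by exact: cvg_cst.
  move=> /near_eq_cvg_to; apply.
  apply: filterS (dir_nbhs_neq0 _ _ _) => h h0 /=.
  by rewrite add0r subr0 [h *: 1]mulr1 /GRing.scale/= mulVf.
have dlin (c : R -> mat) (h : R -> R) : Ck I [set 1] 0 h ->
    hdw A (fun p => c p.2 + p.1 *: (h p.2 *: V)) (0, t) (1, 0) (h t *: V).
  move=> Ch.
  have cc : {within A, continuous (fun p : R * R => h p.2 *: V)}.
    apply: continuous_withinZ; first exact: Ck_continuous (Csnd _ _ _ Ch).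
    by apply/subspace_continuousP => x _; exact: cvg_cst.
  apply: has_derivative_within_eq_val (has_derivative_withinD (cst_snd _ c)
     (has_derivative_withinZ cc A0 dfst (cst_snd _ (fun t => h t *: V)))) _.
  by rewrite /= scale1r scaler0 addr0 add0r.
have dH := dlin W eta (Ceta 0%N); rewrite -/H in dH.
have dN := dlin v deta (Cdeta 0%N); rewrite -/N in dN.
have H0 : H (0, t) = W t by rewrite /H /= scale0r addr0.
have N0 : N (0, t) = v t by rewrite /N /= scale0r addr0.
have cN i j : {within A, continuous (fun p => N p i j)}.
  by apply: Ck_continuous (Ck_entry i j (CN 0%N)).
have cH i j : {within A, continuous (fun p => H p i j)}.
  by apply: Ck_continuous (Ck_entry i j (CH 0%N)).
have Hn0 i j p : A p -> H p i j != 0.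
  by move=> /HM[/(_ i j) + _]; move=> h; rewrite gt_eqF.
have drho : hdw A (rho \o H) (0, t) (1, 0) (eta t * derive_within M rho V (W t)).
  have dP V' (TV' : T0 V') := CkS_derive
    (fun x Mx => dir_nbhs_manifold_proper Mx TV') (Ck_jacobi_factor 1 sF) TV'.
  have fg V' : T0 V' -> forall W0, M W0 -> hdw M rho W0 V' (derive_within M rho V' W0).
    by move=> TV' W0 MW0; have := (dP V' TV').2 W0 MW0.
  have cg V' : T0 V' -> {within M, continuous (derive_within M rho V')}.
    by move=> TV'; have := (dP V' TV').1; exact: Ck_continuous.
  have := has_derivative_within_manifold_comp fg cg A0 (Ck_continuous (CH 0%N)) HM
    (tangent0Z (eta t) TV) dH.
  rewrite H0 -[_ *: V]addr0 (derivative_manifold_lin fg cg _ (MW It) TV tangent0_0).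
  rewrite [X in _ + X](_ : _ = 0) ?addr0//.
  rewrite (derivative_tangent_gen fg cg (MW It) tangent0_0).
  by rewrite big1// => k _; rewrite mxE mul0r.
have c2 : {within A, continuous (fun p => fisher_rao (H p) (N p) (N p))}.
  apply: (Ck_continuous (k := 0) (E := E)).
  apply: Ck_sum => i _; apply: Ck_sum => j _; apply: CkM.
    by apply: CkM; exact: Ck_entry.
  by apply: CkV; [exact: Hn0|exact: Ck_entry].
have c0 : {within A, continuous (fun _ : R * R => 2^-1 : R)}.
  by apply/subspace_continuousP => x _; exact: cvg_cst.
have dfr : hdw A (fun p => fisher_rao (H p) (N p) (N p)) (0, t) (1, 0)
   (\sum_i \sum_j (2 * (v t i j * (deta t * V i j) / W t i j)
      - v t i j ^+ 2 * (eta t * V i j) / W t i j ^+ 2)).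
  apply: has_derivative_within_sum => i; apply: has_derivative_within_sum => j.
  have e1 := has_derivative_within_entry (i := i) (j := j) dN.
  have e2 := has_derivative_within_entry (i := i) (j := j) dH.
  have e3 := has_derivative_withinV (cH i j) A0 (Hn0 i j _ A0) e2.
  have e4 := has_derivative_withinM (cN i j) A0 e1 e1.
  have cV := continuous_withinV (Hn0 i j) (cH i j).
  apply: has_derivative_within_eq_val (has_derivative_withinM cV A0 e4 e3) _.
  rewrite H0 N0 !mxE.
  by field; rewrite gt_eqF//; have [+ _] := MW It; apply.
apply: has_derivative_within_eq_val (has_derivative_withinD
  (has_derivative_withinM c2 A0 (has_derivative_within_cst A (2^-1 : R) (0, t) (1, 0)) dfr) drho) _.
rewrite mul0r add0r /variation_integrand; congr (_ + _).
rewrite /cst mulr_sumr; apply: eq_bigr => i _; rewrite mulr_sumr; apply: eq_bigr => j _.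
by rewrite mulrBr !mulrA mulVf// mul1r.
Qed.

Local Notation a := (acceleration t0 t1 W).

Lemma Ck_acceleration k : Ck I [set 1] k a.
Proof. exact: (Ck_velocity Cv).1. Qed.

Lemma velocity_tangent t : I t -> T0 (v t).
Proof.
move=> It; apply: has_derivative_within_tangent (dW It); first exact: dir_nbhs_itv_proper.
by move=> s Is; apply: tangent0_sub; exact: MW.
Qed.

Lemma acceleration_tangent t : I t -> T0 (a t).
Proof.
move=> It; apply: has_derivative_within_tangent ((Ck_velocity Cv).2 t It).
  exact: dir_nbhs_itv_proper.
move=> s Is; rewrite -[- v t]scaleN1r; apply: tangent0D; first exact: velocity_tangent.
by apply: tangent0Z; exact: velocity_tangent.
Qed.

Lemma Ck_drho k V : T0 V -> Ck I [set 1] k (fun t => derive_within M rho V (W t)).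
Proof.
move=> TV; apply: (Ck_comp_manifold (f := derive_within M rho V)) (CW k) => //.
  by move=> x w Ix ->; exact: dir_nbhs_itv_proper.
exact: (CkS_derive (fun x Mx => dir_nbhs_manifold_proper Mx TV) (Ck_jacobi_factor k.+1 sF) TV).1.
Qed.

(** For tangent [V] this is $g_W(\mathrm{grad}\,\rho - a - \Gamma^g(v,v),\, V)$: the middle sum is
    the pairing of $-\Gamma^g(v,v)$ with [V], by [fisher_rao_connectionE] below. *)
Definition euler_lagrange_form (V : mat) (t : R) : R :=
  derive_within M rho V (W t) + 2^-1 * \sum_i \sum_j V i j * v t i j ^+ 2 / W t i j ^+ 2
  - \sum_i \sum_j V i j * a t i j / W t i j.

Lemma euler_lagrange V t : T0 V -> I t -> euler_lagrange_form V t = 0.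
Proof.
move=> TV It.
have W0 i j s : I s -> W s i j != 0 by move=> /MW[/(_ i j) + _] => h; rewrite gt_eqF.
have Wu i j s : I s -> W s i j ^+ 2 != 0 by move=> Is; rewrite expf_neq0// W0.
have CWe k i j := Ck_entry i j (CW k).
have Cve k i j := Ck_entry i j (Cv k).
have Cae k i j := Ck_entry i j (Ck_acceleration k).
have Cst k (c : R) : Ck I [set 1] k (fun=> c) by exact: Ck_cst.
have Csq k (f : R -> R) : Ck I [set 1] k f -> Ck I [set 1] k (fun s => f s ^+ 2).
  move=> Cf; apply: eq_Ck (CkM Cf Cf) => x _; by rewrite expr2.
have CEV k : Ck I [set 1] k (euler_lagrange_form V).
  apply: CkD; last first.
    apply: CkN; apply: Ck_sum => i _; apply: Ck_sum => j _; apply: CkM.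
      exact: CkM.
    by apply: CkV; [exact: W0|].
  apply: CkD; first exact: Ck_drho.
  apply: CkM => //; apply: Ck_sum => i _; apply: Ck_sum => j _; apply: CkM.
    by apply: CkM => //; exact: Csq.
  by apply: CkV; [exact: Wu|exact: Csq].
(* With eta := w * EL, where w > 0 inside the interval and w = 0 at its endpoints,
   the first variation is the integral of w * EL^2. *)
pose w (s : R) : R := (s - t0) * (t1 - s).
have Cw k : Ck I [set 1] k w.
  apply: CkM; apply: CkD => //; first exact: Ck_id.
  by apply: CkN; exact: Ck_id.
pose eta (s : R) : R := w s * euler_lagrange_form V s.
have Ceta k : Ck I [set 1] k eta by exact: CkM.
have [Cdeta detaP] := Ck_velocity Ceta.
set deta := velocity t0 t1 eta in Cdeta detaP.
have eta0 : eta t0 = 0 by rewrite /eta /w subrr !mul0r.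
have eta1 : eta t1 = 0 by rewrite /eta /w subrr mulr0 mul0r.
have intPsi := integral_variation TV Ceta Cdeta detaP eta0 eta1.
(* The momentum $g_W(v,V)$ in the direction [V]. Since $\eta P$ vanishes at both ends, its
   derivative has integral 0; subtracting it from the first variation removes [deta]. *)
pose P s := \sum_i \sum_j V i j * v s i j / W s i j.
pose dP s := \sum_i \sum_j (V i j * a s i j / W s i j - V i j * v s i j ^+ 2 / W s i j ^+ 2).
have CP k : Ck I [set 1] k P.
  apply: Ck_sum => i _; apply: Ck_sum => j _; apply: CkM; first exact: CkM.
  by apply: CkV; [exact: W0|].
have CdP k : Ck I [set 1] k dP.
  apply: Ck_sum => i _; apply: Ck_sum => j _; apply: CkD.
    by apply: CkM; [exact: CkM|apply: CkV; [exact: W0|]].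
  apply: CkN; apply: CkM; first by apply: CkM => //; exact: Csq.
  by apply: CkV; [exact: Wu|exact: Csq].
have dPP s : I s -> hdw I P s 1 (dP s).
  move=> Is; apply: has_derivative_within_sum => i; apply: has_derivative_within_sum => j.
  have e1 := has_derivative_within_entry (i := i) (j := j) ((Ck_velocity Cv).2 s Is).
  have e2 := has_derivative_within_entry (i := i) (j := j) (dW Is).
  have cW : {within I, continuous (fun s => W s i j)} by exact: Ck_continuous (CWe 0%N i j).
  have e3 := has_derivative_withinV cW Is (W0 i j s Is) e2.
  have cv : {within I, continuous (fun s => v s i j)} by exact: Ck_continuous (Cve 0%N i j).
  have e4 := has_derivative_withinM cv Is (has_derivative_within_cst I (V i j) s 1) e1.
  have cWV := continuous_withinV (W0 i j) cW.
  apply: has_derivative_within_eq_val (has_derivative_withinM cWV Is e4 e3) _.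
  by rewrite /acceleration /cst; field; exact: W0.
have Cpsi k : Ck I [set 1] k (variation_integrand eta deta V).
  apply: CkD; last by apply: CkM => //; exact: Ck_drho.
  apply: Ck_sum => i _; apply: Ck_sum => j _; apply: CkD.
    apply: CkM; last by apply: CkV; [exact: W0|].
    by apply: CkM => //; exact: CkM.
  apply: CkN; apply: CkM; last by apply: CkV; [exact: Wu|exact: Csq].
  apply: CkM; last exact: CkM.
  by apply: CkM => //; exact: Csq.
have CetaP k : Ck I [set 1] k (fun s => deta s * P s + eta s * dP s).
  by apply: CkD; exact: CkM.
have parts : \int[mu]_(s in I) (deta s * P s + eta s * dP s) = 0.
  rewrite (@Rintegral_derivative_within _ t0 t1 (fun s => eta s * P s))//.
  - by rewrite eta0 eta1 !mul0r subrr.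
  - exact: Ck_continuous (CkM (Ceta 0%N) (CP 0%N)).
  - exact: Ck_continuous (CetaP 0%N).
  - move=> s Is; apply: has_derivative_withinM => //; last 2 first.
    + exact: detaP.
    + exact: dPP.
    + exact: Ck_continuous (CP 0%N).
have E s : I s -> eta s * euler_lagrange_form V s =
    variation_integrand eta deta V s - (deta s * P s + eta s * dP s).
  move=> Is.
  pose Q := \sum_i \sum_j V i j * v s i j ^+ 2 / W s i j ^+ 2.
  have HdP : dP s = \sum_i \sum_j V i j * a s i j / W s i j - Q.
    by rewrite /dP /Q -sumrB; apply: eq_bigr => i _; rewrite -sumrB.
  have HPsi : variation_integrand eta deta V s =
      deta s * P s - eta s * (2^-1 * Q) + eta s * derive_within M rho V (W s).
    congr (_ + _); rewrite /P /Q !mulr_sumr -sumrB; apply: eq_bigr => i _.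
    rewrite !mulr_sumr -sumrB; apply: eq_bigr => j _.
    congr (_ - _); first by ring.
    by ring.
  by rewrite HPsi HdP /euler_lagrange_form -/Q; field.
have int0 : \int[mu]_(s in I) (eta s * euler_lagrange_form V s) = 0.
  rewrite (eq_Rintegral mu (g := fun s => variation_integrand eta deta V s
    - (deta s * P s + eta s * dP s))); last first.
    by move=> s; rewrite inE; exact: E.
  have mI := @measurable_itv R `[t0, t1].
  rewrite /= (@RintegralB _ _ R mu _ _ _ mI).
  - by rewrite intPsi parts subrr.
  - by apply: continuous_itv_integrable; exact: Ck_continuous (Cpsi 0%N).
  - by apply: continuous_itv_integrable; exact: Ck_continuous (CetaP 0%N).
(* The weight [w] degenerates at the endpoints, so only interior points are read off from the
   integral; continuity supplies the rest. *)
apply: (eq0_itv_closed t01 (Ck_continuous (CEV 0%N))) It => s s01.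
have Is := subset_itv_oo_cc s01.
have sq x : eta x * euler_lagrange_form V x = w x * euler_lagrange_form V x ^+ 2.
  by rewrite /eta expr2 mulrA.
have nneg x : I x -> 0 <= eta x * euler_lagrange_form V x.
  rewrite sq /= in_itv/= => /andP[x0 x1].
  by rewrite mulr_ge0 ?sqr_ge0// mulr_ge0 ?subr_ge0.
have := Rintegral_eq0 t01 (Ck_continuous (CkM (Ceta 0%N) (CEV 0%N))) nneg int0 Is.
rewrite sq => /eqP; rewrite mulf_eq0 sqrf_eq0 => /orP[|/eqP//].
move: s01; rewrite in_itv/= => /andP[s0 s1].
by rewrite gt_eqF// mulr_gt0 ?subr_gt0.
Qed.

End Variation.

(** * Change of parameter and geodesics *)

Section Reparametrization.
Context {R : realType}.
Local Notation hdw := has_derivative_within.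
Local Notation mu := (@lebesgue_measure R).

(** The new parameter is a primitive [sigma] of [r], strictly increasing because [r > 0], and [phi]
    is its inverse. *)
Lemma reparametrization_exists (t0 t1 : R) (r : R -> R) : t0 < t1 ->
  (forall k, Ck `[t0, t1] [set 1] k r) -> (forall t, t \in `[t0, t1] -> 0 < r t) ->
  exists (a b : R) (phi : R -> R),
    [/\ a < b, phi a = t0, phi b = t1, forall k, Ck `[a, b] [set 1] k phi &
      forall s, s \in `[a, b] -> phi s \in `[t0, t1] /\ hdw `[a, b] phi s 1 (r (phi s))^-1].
Proof.
move=> t01 Cr r0.
(* r is extended by constants, so that the primitive sigma of r and its inverse
   phi have two-sided derivatives also at the endpoints. *)
pose clamp (t : R) : R := Num.max t0 (Num.min t t1).
have clampI t : clamp t \in `[t0, t1].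
  rewrite in_itv/= /clamp le_max lexx/= ge_max (ltW t01)/=.
  by rewrite ge_min lexx orbT.
have clampE t : t \in `[t0, t1] -> clamp t = t.
  rewrite in_itv/= => /andP[h1 h2]; rewrite /clamp min_l//; exact: max_r.
have cclamp : continuous clamp.
  move=> x; apply: (@continuous_max R R (cst t0) (fun t => Num.min t t1)); first exact: cvg_cst.
  by apply: (@continuous_min R R id (cst t1)); [exact: cvg_id|exact: cvg_cst].
pose rr t := r (clamp t).
have crr : continuous rr.
  move=> x; have /subspace_continuousP/(_ (clamp x) (clampI x)) := Ck_continuous (Cr 0%N).
  apply: cvg_comp => P /= IP.
  have H : \forall y \near x, clamp y \in `[t0, t1] -> P (clamp y) by exact: cclamp x _ IP.
  suff : \forall y \near x, P (clamp y) by [].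
  by apply: filterS H => y; apply; exact: clampI.
have rr0 t : 0 < rr t by apply: r0; exact: clampI.
pose J := `](t0 - 1), (t1 + 1)[.
(* Integrating from [t0 - 1] puts [[t0, t1]] inside the open interval [J], where the fundamental
   theorem applies at every point. The margin 1 is arbitrary. *)
pose sigma x := \int[mu]_(t in `[t0 - 1, x]) rr t.
have dsigma x : x \in J -> is_derive x (1 : R) sigma (rr x).
  rewrite in_itv/= => /andP[x0 x1].
  have int : mu.-integrable `[t0 - 1, t1 + 1] (EFin \o rr).
    by apply: continuous_itv_integrable; exact: continuous_subspaceT.
  have [d1 d2] := continuous_FTC1_closed x1 int x0 (crr x).
  have dE : 'D_(1 : R) sigma x = rr x by rewrite -derive1E; exact: d2.
  exact: DeriveDef d1 dE.
clearbody sigma.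
have IJ t : t \in `[t0, t1] -> t \in J.
  by rewrite /J !in_itv/= => /andP[h1 h2]; apply/andP; split; lra.
have mono x y : x \in J -> y \in J -> x < y -> sigma x < sigma y.
  rewrite !in_itv/= => /andP[x0 x1] /andP[y0 y1] xy.
  have sub z : z \in `[x, y] -> z \in J.
    by rewrite /J !in_itv/= => /andP[h1 h2]; apply/andP; split; lra.
  have h1 z : z \in `]x, y[ -> is_derive z (1 : R) sigma (rr z).
    by move=> zxy; apply: dsigma; apply: sub; exact: subset_itv_oo_cc.
  have h2 : {within `[x, y], continuous sigma}.
    by apply: derivable_within_continuous => z zxy; have [] := dsigma z (sub z zxy).
  have [c cxy E] := MVT xy h1 h2.
  by rewrite -subr_gt0 E mulr_gt0// subr_gt0.
have inj x y : x \in J -> y \in J -> sigma x = sigma y -> x = y.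
  move=> xJ yJ E; have [xy|yx|//] := ltgtP x y.
    by have := mono _ _ xJ yJ xy; rewrite E ltxx.
  by have := mono _ _ yJ xJ yx; rewrite E ltxx.
(* The default [t0] is taken only at values that [sigma] does not attain on [J]. *)
pose phi s := xget t0 [set x | x \in J /\ sigma x = s].
have phiK x : x \in J -> phi (sigma x) = x.
  move=> xJ; rewrite /phi; case: xgetP => [y _ [yJ /inj]|/(_ x)]; first exact.
  by move=> /not_andP[].
have t0I : t0 \in `[t0, t1] by rewrite in_itv/= lexx ltW.
have t1I : t1 \in `[t0, t1] by rewrite in_itv/= lexx ltW.
have csigma : {within `[t0, t1], continuous sigma}.
  by apply: derivable_within_continuous => z /IJ/dsigma[].
have surj s : s \in `[sigma t0, sigma t1] -> exists2 t, t \in `[t0, t1] & sigma t = s.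
  move=> sI; have s01 := mono _ _ (IJ _ t0I) (IJ _ t1I) t01.
  have h : Num.min (sigma t0) (sigma t1) <= s <= Num.max (sigma t0) (sigma t1).
    have -> : Num.min (sigma t0) (sigma t1) = sigma t0 by apply: min_l; exact: ltW.
    have -> : Num.max (sigma t0) (sigma t1) = sigma t1 by apply: max_r; exact: ltW.
    by move: sI; rewrite in_itv.
  by have [t tI E] := IVT (ltW t01) csigma h; exists t.
have dphi t : t \in `[t0, t1] -> is_derive (sigma t) (1 : R) phi (r t)^-1.
  move=> tI; have tJ := IJ _ tI.
  have nJ : \forall x \near t, x \in J by exact: near_in_itvoo.
  have -> : r t = rr t by rewrite /rr clampE.
  apply: is_derive_inverse (dsigma _ tJ) _; last by rewrite gt_eqF.
  - by apply: filterS nJ => x; exact: phiK.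
  - apply: filterS nJ => x /dsigma[dx _].
    exact/differentiable_continuous/derivable1_diffP.
exists (sigma t0), (sigma t1), phi.
have cphi : {within `[sigma t0, sigma t1], continuous phi}.
  apply: derivable_within_continuous => s /surj[t tI <-].
  by have [] := dphi t tI.
have phiI s : s \in `[sigma t0, sigma t1] ->
  phi s \in `[t0, t1] /\ hdw `[sigma t0, sigma t1] phi s 1 (r (phi s))^-1.
  move=> /surj[t tI <-]; rewrite phiK; last exact: IJ.
  by split => //; apply: is_derive_has_derivative_within; exact: dphi.
split => //.
- exact: mono (IJ _ t0I) (IJ _ t1I) t01.
- by apply: phiK; exact: IJ.
- by apply: phiK; exact: IJ.
(* Bootstrap: $\varphi' = 1/(r\circ\varphi)$ is as regular as $\varphi$, so each order of smoothness
   yields the next. *)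
- elim=> [|k IH]; split => // v ->.
  exists (fun s => (r (phi s))^-1); first by move=> s /phiI[].
  apply: CkV; first by move=> s /phiI[/r0 h _]; rewrite gt_eqF.
  by apply: (Ck_comp_curve (f := r)) IH (Cr k) => s /phiI[].
Qed.

End Reparametrization.

(** * Levi-Civita connections of the Fisher-Rao and Jacobi metrics *)

Section LeviCivita.
Context {R : realType} {m n : nat}.
Local Notation M := (@assignment_manifold R m n).
Local Notation T0 := (@tangent0 R m n).
Local Notation mat := 'M[R]_(m, n).
Implicit Types (W U V X : mat).
Local Notation hdw := has_derivative_within.
Local Notation g := (@fisher_rao R m n).

Lemma fisher_rao_linl W (k : R) U U' V : g W (k *: U + U') V = k * g W U V + g W U' V.
Proof.
rewrite /fisher_rao mulr_sumr -big_split/=; apply: eq_bigr => i _.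
rewrite mulr_sumr -big_split/=; apply: eq_bigr => j _.
by rewrite !mxE; ring.
Qed.

Lemma fisher_raoC W U V : g W U V = g W V U.
Proof. by apply: eq_bigr => i _; apply: eq_bigr => j _; rewrite [U i j * _]mulrC. Qed.

Lemma fisher_raoZl W (k : R) U V : g W (k *: U) V = k * g W U V.
Proof.
by rewrite -[k *: U]addr0 fisher_rao_linl /fisher_rao [X in _ + X]big1 ?addr0// => i _;
  rewrite big1// => j _; rewrite mxE !mul0r.
Qed.

Lemma fisher_rao_eq0 W V : M W -> g W V V = 0 -> V = 0.
Proof.
move=> [W0 _] /eqP; rewrite /fisher_rao pair_big/= psumr_eq0; last first.
  by move=> ij _; rewrite divr_ge0 ?(ltW (W0 _ _))// -expr2 sqr_ge0.
move=> /allP H; apply/matrixP => i j; rewrite mxE.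
have := H (i, j) (mem_index_enum _).
by rewrite /= mulf_eq0 invr_eq0 (gt_eqF (W0 i j)) orbF mulf_eq0 orbb => /eqP.
Qed.

Lemma has_derivative_within_fisher_rao W X U V : M W -> T0 X ->
  hdw M (fun W' => g W' U V) W X (- \sum_i \sum_j X i j * U i j * V i j / W i j ^+ 2).
Proof.
move=> MW TX; rewrite -sumrN; apply: has_derivative_within_sum => i.
rewrite -sumrN; apply: has_derivative_within_sum => j.
have W0 W' : M W' -> W' i j != 0 by move=> [/(_ i j) h _]; rewrite gt_eqF.
have e1 := has_derivative_within_entry (i := i) (j := j) (@has_derivative_within_id _ _ M W X).
have c1 : {within M, continuous (fun W' : mat => W' i j)}.
  by apply: (Ck_continuous (k := 0) (E := T0)); apply: Ck_entry; exact: Ck_id.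
have e2 := has_derivative_withinV c1 MW (W0 _ MW) e1.
apply: has_derivative_within_eq_val (has_derivative_withinM (continuous_withinV W0 c1) MW
  (has_derivative_within_cst M (U i j * V i j) W X) e2) _.
by rewrite /cst; field; exact: W0.
Qed.

Lemma derive_manifold (f : mat -> R) W X l : M W -> T0 X -> hdw M f W X l -> 'D_X f W = l.
Proof.
move=> MW TX fl.
have H : (fun h : R => h^-1 *: (f (W + h *: X) - f W)) @ (0 : R)^' --> l.
  by move=> P /fl /(dir_nbhs_manifold _ MW TX).
apply: cvg_lim => //.
by under eq_fun do rewrite /= [_ + W]addrC.
Qed.

(** The derivative of $g(U,V)$ along $X$ is $-\sum XUV/W^2$, symmetric in all three arguments, so
    Koszul's formula gives $g(\Gamma(U,V),X) = -\tfrac12\sum UVX/W^2$. Hence $\Gamma(U,V)$ is the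
    tangential part of $-\tfrac12 UV/W$; the correction in each row is a multiple of $W_i$, which is
    $g$-orthogonal to tangent vectors. *)
Definition fisher_rao_connection W U V : mat :=
  \matrix_(i, j) (- 2^-1 * (U i j * V i j / W i j - W i j * \sum_k U i k * V i k / W i k)).

Lemma fisher_rao_connection_tangent W U V : M W -> T0 (fisher_rao_connection W U V).
Proof.
move=> /assignment_manifoldP[_ W1]; apply/tangent0P => i.
under eq_bigr do rewrite mxE.
by rewrite -mulr_sumr big_split/= sumrN -mulr_suml W1 mul1r subrr mulr0.
Qed.

Lemma fisher_rao_connectionE W U V X : M W -> T0 X ->
  g W (fisher_rao_connection W U V) X =
  - 2^-1 * \sum_i \sum_j U i j * V i j * X i j / W i j ^+ 2.
Proof.
move=> [W0 _] /tangent0P TX; rewrite mulr_sumr; apply: eq_bigr => i _.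
transitivity (\sum_j (- 2^-1 * (U i j * V i j * X i j / W i j ^+ 2)
    + (2^-1 * \sum_k U i k * V i k / W i k) * X i j)).
  by apply: eq_bigr => j _; rewrite mxE; field; rewrite gt_eqF.
by rewrite big_split/= -mulr_sumr -mulr_sumr TX mulr0 addr0.
Qed.

Section Jacobi.
Variable (F : mat -> mat).
Hypothesis sF : smooth_field F.
Local Notation rho := (jacobi_factor F).

Definition drho W V : R := derive_within M rho V W.

Lemma drhoP W V : M W -> T0 V -> hdw M rho W V (drho W V).
Proof.
move=> MW TV.
exact: (CkS_derive (fun x Mx => dir_nbhs_manifold_proper Mx TV) (Ck_jacobi_factor 1 sF) TV).2.
Qed.

Lemma continuous_drho V : T0 V -> {within M, continuous (fun W => drho W V)}.
Proof.
move=> TV; apply: (Ck_continuous (k := 0) (E := T0)).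
exact: (CkS_derive (fun x Mx => dir_nbhs_manifold_proper Mx TV) (Ck_jacobi_factor 1 sF) TV).1.
Qed.

Let drhoP' V : T0 V -> forall W, M W -> hdw M rho W V (drho W V).
Proof. by move=> TV W MW; exact: drhoP. Qed.

Lemma drho_gen W V : M W -> T0 V ->
  drho W V = \sum_k V k.1 k.2 * drho W (tangent_gen k).
Proof. exact: (derivative_tangent_gen (g := fun V W => drho W V) drhoP' continuous_drho). Qed.

Lemma drho_lin W (k : R) U V : M W -> T0 U -> T0 V ->
  drho W (k *: U + V) = k * drho W U + drho W V.
Proof. exact: (derivative_manifold_lin (g := fun V W => drho W V) drhoP' continuous_drho). Qed.

Lemma has_derivative_within_rho_comp (A : set R) (c : R -> mat) x L :
  A x -> {within A, continuous c} -> (forall y, A y -> M (c y)) -> T0 L ->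
  hdw A c x 1 L -> hdw A (rho \o c) x 1 (drho (c x) L).
Proof. exact: (has_derivative_within_manifold_comp (g := fun V W => drho W V) drhoP' continuous_drho). Qed.

(** The matrix of derivatives along the [tangent_gen k] represents $d\rho$ for the Euclidean
    pairing, since the coefficients of a tangent [V] over this family are its entries; the
    replicator operator then makes it the Fisher-Rao gradient. *)
Definition grad_rho W : mat :=
  replicator W (\matrix_(i, j) drho W (tangent_gen (i, j))).

Lemma grad_rhoE W V : M W -> T0 V -> g W (grad_rho W) V = drho W V.
Proof.
move=> MW TV; rewrite fisher_rao_replicator// drho_gen// pair_big/=.
by apply: eq_bigr => -[i j] _; rewrite mxE mulrC.
Qed.

(* The change of the Levi-Civita connection under the conformal change g -> rho g. *)
Definition jacobi_connection W U V : mat :=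
  (2 * rho W)^-1 *:
    (drho W U *: V + (drho W V *: U + (- g W U V) *: grad_rho W))
  + fisher_rao_connection W U V.

(** In the compatibility condition the terms with $d\rho(U)$ and $d\rho(V)$ cancel between the two
    summands. The two halves of $d\rho(X)\,g(U,V)$ add up to the derivative of the conformal factor,
    and the two Fisher-Rao terms to $\rho$ times the derivative of $g$. *)
Lemma jacobi_levi_civita : levi_civita (Qset F) (jacobi_metric F) jacobi_connection.
Proof.
move=> W [MW Gneg].
have r0 : rho W != 0 by rewrite gt_eqF// /jacobi_factor sub0r oppr_gt0.
have W0 i j : W i j != 0 by have [+ _] := MW; move=> h; rewrite gt_eqF.
have Tgrad : T0 (grad_rho W) by exact: replicator_tangent.
split.
- move=> U V TU TV; apply: tangent0_lin; last exact: fisher_rao_connection_tangent.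
  by apply: tangent0_lin => //; apply: tangent0_lin => //; exact: tangent0Z.
- move=> k U U' V TU TU' TV; rewrite /jacobi_connection drho_lin// fisher_rao_linl.
  have -> : fisher_rao_connection W (k *: U + U') V =
      k *: fisher_rao_connection W U V + fisher_rao_connection W U' V.
    apply/matrixP => i j; rewrite !mxE.
    have -> : \sum_l (k *: U + U') i l * V i l / W i l =
        k * (\sum_l U i l * V i l / W i l) + \sum_l U' i l * V i l / W i l.
      rewrite mulr_sumr -big_split/=; apply: eq_bigr => l _.
      by rewrite !mxE; ring.
    by ring.
  apply/matrixP => i j; rewrite !mxE.
  move: (fisher_rao_connection W U V i j) (fisher_rao_connection W U' V i j) => G1 G2.
  move: (grad_rho W i j) (_^-1) => G3 c.
  move: (drho W U) (drho W U') (drho W V) (g W U V) (g W U' V) => x1 x2 x3 x4 x5.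
  move: (U i j) (U' i j) (V i j) => y1 y2 y3.
  by ring.
- move=> U V TU TV; rewrite /jacobi_connection addrA [_ + _ *: U]addrC -addrA.
  rewrite (fisher_raoC W U V); congr (_ + _).
  apply/matrixP => i j; rewrite !mxE; congr (_ * (_ - _ * _)).
    by rewrite [U i j * _]mulrC.
  by apply: eq_bigr => k _; rewrite [U i k * _]mulrC.
move=> X U V TX TU TV.
have cg : {within M, continuous (fun W' => g W' U V)}.
  apply: (Ck_continuous (k := 0) (E := T0)).
  apply: Ck_sum => i _; apply: Ck_sum => j _; apply: CkM; first exact: Ck_cst.
  apply: CkV; last by apply: Ck_entry; exact: Ck_id.
  by move=> W' [/(_ i j) h _]; rewrite gt_eqF.
rewrite (derive_manifold MW TX (has_derivative_withinM cg MW (drhoP MW TX)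
  (@has_derivative_within_fisher_rao W X U V MW TX))).
rewrite /jacobi_metric -/(rho W) /jacobi_connection.
rewrite [g W U (_ + _)]fisher_raoC !fisher_rao_linl !fisher_raoZl.
rewrite !grad_rhoE// !fisher_rao_connectionE//.
rewrite [g W V U]fisher_raoC.
have -> : \sum_i \sum_j X i j * V i j * U i j / W i j ^+ 2 =
    \sum_i \sum_j X i j * U i j * V i j / W i j ^+ 2.
  by apply: eq_bigr => i _; apply: eq_bigr => j _; rewrite [X i j * _ * _]mulrAC.
move: (\sum_i \sum_j _) (g W U V) (g W X V) (g W X U) => s1 s2 s3 s4.
move: (drho W X) (drho W U) (drho W V) => d1 d2 d3.
by move: (rho W) r0 => r r0; field.
Qed.

(** The pregeodesic equation in the time parameter. With $g(v,v)=2\rho$ the conformal correction is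
    $(d\rho(v)/\rho)\,v - \mathrm{grad}\,\rho$, and its gradient is cancelled by the Euler-Lagrange
    equation. *)
Lemma jacobi_geodesic_acceleration W v a : M W -> T0 v -> T0 a ->
  2 * jacobi_factor F W = g W v v -> jacobi_factor F W != 0 ->
  (forall V, T0 V -> drho W V + 2^-1 * \sum_i \sum_j V i j * v i j ^+ 2 / W i j ^+ 2
  - \sum_i \sum_j V i j * a i j / W i j = 0) ->
  a + jacobi_connection W v v = (drho W v / rho W) *: v.
Proof.
move=> MW Tv Ta E r0 EL.
have Tgrad : T0 (grad_rho W) by exact: replicator_tangent.
(* The residual $a+\Gamma^g(v,v)-\mathrm{grad}\,\rho$ is tangent, so the hypothesis may be tested on
   [Z] itself; this reads $g(Z,Z)=0$. *)
pose Z := (-1 : R) *: grad_rho W + (a + fisher_rao_connection W v v).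
have TZ : T0 Z.
  apply: tangent0_lin => //; apply: tangent0D => //.
  exact: fisher_rao_connection_tangent.
have Z0 : Z = 0.
  apply: (fisher_rao_eq0 MW).
  rewrite {1}/Z fisher_rao_linl grad_rhoE// -[a]scale1r fisher_rao_linl fisher_rao_connectionE//.
  rewrite -[RHS]oppr0 -[X in _ = - X](EL _ TZ).
  have -> : g W a Z = \sum_i \sum_j Z i j * a i j / W i j.
    by rewrite fisher_raoC.
  have -> : \sum_i \sum_j v i j * v i j * Z i j / W i j ^+ 2 =
     \sum_i \sum_j Z i j * v i j ^+ 2 / W i j ^+ 2.
    by apply: eq_bigr => i _; apply: eq_bigr => j _; rewrite mulrC mulrA expr2 mulrC; ring.
  by ring.
have -> : a + jacobi_connection W v v = Z + (drho W v / rho W) *: v.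
  rewrite /Z /jacobi_connection -E.
  move: (fisher_rao_connection _ _ _) (grad_rho W) => G1 G2.
  by apply/matrixP => i j; rewrite !mxE; field.
by rewrite Z0 add0r.
Qed.

End Jacobi.
End LeviCivita.

Theorem proposition4p4 (R : realType) (m n : nat) (hm : (0 < m)%N) (hn : (0 < n)%N)
  (F : 'M[R]_(m, n) -> 'M[R]_(m, n)) (hF : smooth_field F)
  (t0 t1 : R) (ht : t0 < t1) (h0 : 0 \in `[t0, t1])
  (W : R -> 'M[R]_(m, n))
  (hW : integral_curve F t0 t1 W)
  (hcrit : critical_point (action_functional F t0 t1) t0 t1 W)
  (hQ : Qset F (W 0)) :
  (exists (a b : R) (phi : R -> R),
    [/\ a < b, reparametrization a b t0 t1 phi &
        geodesic (Qset F) (jacobi_metric F) a b (W \o phi)]) /\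
  (forall P U V : 'M[R]_(m, n), Qset F P -> tangent0 U -> tangent0 V ->
    jacobi_metric F P U V =
      2^-1 * (\sum_(k < m) Var (rowvec P k) (rowvec (F P) k)) * fisher_rao P U V).
Proof.
split; last first.
  by move=> P U V _ _ _; rewrite /jacobi_metric /potential sub0r [- 2^-1 * _]mulNr opprK.
have sW : smooth_curve t0 t1 W by have [] := hcrit.
have MW t : t \in `[t0, t1] -> assignment_manifold (W t) by move=> /hW[].
have CW := (smooth_curve_Ck ht W).1 sW.
pose r t := jacobi_factor F (W t).
have rE t : r t = - potential F (W t) by rewrite /r /jacobi_factor sub0r.
have r_gt0 t : t \in `[t0, t1] -> 0 < r t.
  move=> tI; apply: (jacobi_factor_gt0 hF ht hW sW h0 tI).
  by rewrite -/(r 0) rE oppr_gt0; have [] := hQ.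
have r_neq0 t : t \in `[t0, t1] -> r t != 0 by move=> /r_gt0 h; rewrite gt_eqF.
have Cr k : Ck `[t0, t1] [set 1] k r.
  apply: (Ck_comp_manifold (f := jacobi_factor F)) (CW k) => //.
    by move=> x w Ix ->; exact: dir_nbhs_itv_proper.
  exact: Ck_jacobi_factor.
have [a [b [phi [ab phia phib Cphi phiP]]]] := reparametrization_exists ht Cr r_gt0.
have phiI s : s \in `[a, b] -> phi s \in `[t0, t1] by move=> /phiP[].
have dphi s : s \in `[a, b] -> has_derivative_within `[a, b] phi s 1 (r (phi s))^-1.
  by move=> /phiP[].
have cphi := Ck_continuous (Cphi 0%N).
exists a, b, phi; split => //.
  split => //; first exact/(smooth_curve_Ck ab).
  by move=> s sI; rewrite (velocityP ab sI (dphi s sI)) invr_gt0 r_gt0// phiI.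
have comp (U : normedModType R) (f : R -> U) df s : s \in `[a, b] ->
    has_derivative_within `[t0, t1] f (phi s) 1 df ->
    has_derivative_within `[a, b] (f \o phi) s 1 ((r (phi s))^-1 *: df).
  by move=> sI; apply: has_derivative_within_comp_curve => //; exact: dphi.
have [Cv dW] := Ck_velocity ht CW.
set v := velocity t0 t1 W in Cv dW.
have [_ dv] := Ck_velocity ht Cv.
have vE s : s \in `[a, b] -> velocity a b (W \o phi) s = (r (phi s))^-1 *: v (phi s).
  move=> sI; apply: (velocityP ab sI); apply: comp => //.
  by apply: dW; exact: phiI.
split.
- by apply/(smooth_curve_Ck ab) => k; apply: Ck_comp_curve (Cphi k) (CW k) => s; exact: phiI.
- move=> s sI; split; first by apply: MW; exact: phiI.
  by have := r_gt0 _ (phiI s sI); rewrite rE oppr_gt0.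
exists (jacobi_connection F); first exact: jacobi_levi_civita.
move=> s sI; have tI := phiI s sI; set t := phi s in tI *.
have MWt := MW t tI.
have Tv : tangent0 (v t) by exact: (velocity_tangent ht hcrit tI).
have Ta : tangent0 (acceleration t0 t1 W t) by exact: (acceleration_tangent ht hcrit tI).
have crp : {within `[a, b], continuous (r \o phi)}.
  by apply: Ck_continuous (Ck_comp_curve phiI (Cphi 0%N) (Cr 0%N)).
have cvp : {within `[a, b], continuous (v \o phi)}.
  by apply: Ck_continuous (Ck_comp_curve phiI (Cphi 0%N) (Cv 0%N)).
have dr : has_derivative_within `[t0, t1] r t 1 (drho F (W t) (v t)).
  apply: (has_derivative_within_rho_comp hF) => //; last exact: dW.
  exact: Ck_continuous (CW 0%N).
have drp := has_derivative_withinV crp sI (r_neq0 _ tI) (comp _ _ _ _ sI dr).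
have dvp := comp _ _ _ _ sI (dv t tI).
(* The new velocity is $v/r$; differentiating the factor $1/r$ with $\varphi'=1/r$ creates
   $-(d\rho(v)/r)\,v$, the opposite of the tangential term in [key]. *)
have acc : acceleration a b (W \o phi) s =
    (r t ^+ 2)^-1 *: (acceleration t0 t1 W t - (drho F (W t) (v t) / r t) *: v t).
  apply: (velocityP ab sI).
  apply: (eq_has_derivative_within (f := fun y => ((r \o phi) y)^-1 *: (v \o phi) y)) => //.
    by move=> y yI; rewrite vE.
  apply: has_derivative_within_eq_val (has_derivative_withinZ cvp sI drp dvp) _.
  rewrite /acceleration -/v /= -/t scalerA scalerBr scalerA addrC; congr (_ + _).
    by rewrite -expr2 exprVn.
  rewrite -scaleNr; congr (_ *: _); rewrite /GRing.scale/=.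
  by field; exact: r_neq0.
have twor : 2 * jacobi_factor F (W t) = fisher_rao (W t) (v t) (v t).
  have [_ _ vt] := hW t tI.
  by rewrite jacobi_factor_fisher_rao// -vt mulrA mulfV ?mul1r.
have key := jacobi_geodesic_acceleration hF MWt Tv Ta twor (r_neq0 _ tI)
  (fun V TV => euler_lagrange hF ht hcrit TV tI).
have jE (k : R) : jacobi_connection F (W t) (k *: v t) (k *: v t) =
    k ^+ 2 *: jacobi_connection F (W t) (v t) (v t).
  have QW : Qset F (W t) by split=> //; have := r_gt0 t tI; rewrite rE oppr_gt0.
  have [_ lin sym _] := jacobi_levi_civita hF QW.
  have Z1 U V : tangent0 U -> tangent0 V ->
      jacobi_connection F (W t) (k *: U) V = k *: jacobi_connection F (W t) U V.
    move=> TU TV; have T0 := @tangent0_0 R m n.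
    (* The value at the zero direction equals twice itself, hence vanishes; this turns the combined
       linearity clause into homogeneity. *)
    have := lin 1 0 0 V T0 T0 TV; rewrite scaler0 addr0 scale1r -{1}[jacobi_connection _ _ _ _]addr0.
    move=> /addrI J1.
    by have := lin k U 0 V TU T0 TV; rewrite addr0 -J1 addr0.
  have Tk : tangent0 (k *: v t) by exact: tangent0Z.
  by rewrite Z1// sym// Z1// scalerA expr2.
(* Both the acceleration and the connection term carry the factor $r^{-2}$; what it multiplies is
   the difference of the two sides of [key]. *)
rewrite vE// -/t jE acc exprVn -scalerDr -addrA [- _ + _]addrC addrA key subrr scaler0.
by [].
Qed.
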